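(* Let $\eta,T>0$, $\mathbf F\in\mathbb R^d$ and $\Omega=\mathbb T^d_{\boldsymbol L}$. Suppose there exists a divergence-free velocity field $\boldsymbol v\in L^2(0,T;L^2_{\mathrm{per},0}(\Omega;\mathbb R^d))$ satisfying $$\partial_t\boldsymbol b=\eta\nabla^2\boldsymbol b+\nabla\times(\boldsymbol v\times\mathbf F),\qquad\nabla\cdot\boldsymbol b=0$$ for a given magnetic field $\boldsymbol b\in L^2(0,T;H^2_{\mathrm{per}}(\Omega;\mathbb R^d))\cap C([0,T];H^1_{\mathrm{per}}(\Omega;\mathbb R^d))$. This velocity field is unique (among divergence-free fields in $L^2(0,T;L^2_{\mathrm{per},0}(\Omega;\mathbb R^d))$) if and only if $\mathbf F$ is incommensurable with respect to the lattice $\boldsymbol L$, i.e., $$\mathbf F\cdot\boldsymbol g(\boldsymbol k)\neq0\qquad\text{for all }\boldsymbol k\in\mathbb Z^d\setminus\{\boldsymbol 0\},\qquad \boldsymbol g(\boldsymbol k)=\Big(\frac{k_1}{L_1},\dots,\frac{k_d}{L_d}\Big).$$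
   Context: Throughout, $d\in\{2,3\}$. For $\boldsymbol L=(L_1,\dots,L_d)$ with all $L_i>0$, $\mathbb T^d_{\boldsymbol L}$ is the torus with side lengths $L_1,\dots,L_d$. $H^k_{\mathrm{per}}(\Omega;\mathbb R^d)$ are periodic Sobolev vector fields, and $L^2_{\mathrm{per},0}(\Omega;\mathbb R^d)$ is the space of periodic $L^2$ vector fields with zero mean over $\Omega$. Equations are understood in the sense of distributions; divergence-free means $\nabla\cdot\boldsymbol v(t,\cdot)=0$ for a.e. $t$. For constant $\mathbf F$, $\nabla\times(\boldsymbol v\times\mathbf F)=(\mathbf F\cdot\nabla)\boldsymbol v-\mathbf F(\nabla\cdot\boldsymbol v)$; for $d=2$, $\boldsymbol v\times\mathbf F=v_1F_2-v_2F_1$ is a scalar and the curl of a scalar $\psi$ is $(\partial_2\psi,-\partial_1\psi)$. *)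

(* Defs.v *)
From HB Require Import structures.
From mathcomp Require Import all_boot all_order all_algebra.
From mathcomp Require Import all_classical all_reals all_analysis.

Set Implicit Arguments.
Unset Strict Implicit.
Unset Printing Implicit Defensive.

Import Order.TTheory GRing.Theory Num.Theory.
Import numFieldNormedType.Exports.

Local Open Scope classical_set_scope.
Local Open Scope ring_scope.

(* The library has a sigma-algebra on [n.-tuple T] but none on ['rV[R]_n];
   this is the same product (Borel) one, generated by the coordinates. *)
Definition measure_rV_display : measure_display.
Proof. exact: default_measure_display. Qed.

Section measurable_rV.
Context {R : realType} {n : nat}.

Let coords : 'I_n -> 'rV[R]_n -> R := fun i x => x 0 i.

Let rV_set0 : g_sigma_preimage coords set0.
Proof. exact: sigma_algebra0. Qed.

Let rV_setC A : g_sigma_preimage coords A -> g_sigma_preimage coords (~` A).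
Proof. exact: sigma_algebraC. Qed.

Let rV_bigcup (A : _^nat) : (forall i, g_sigma_preimage coords (A i)) ->
  g_sigma_preimage coords (\bigcup_i (A i)).
Proof. exact: sigma_algebra_bigcup. Qed.

HB.instance Definition _ := @isMeasurable.Build measure_rV_display
  'rV[R]_n (g_sigma_preimage coords) rV_set0 rV_setC rV_bigcup.

End measurable_rV.

Lemma measurable_coord_rV (R : realType) n (i : 'I_n) :
  measurable_fun [set: 'rV[R]_n] (fun x => x 0 i).
Proof.
move=> _ Y mY; rewrite setTI; apply: sub_sigma_algebra => /=.
rewrite -bigcup_seq/=; exists i => /=; first by rewrite mem_index_enum.
by exists Y => //; rewrite setTI.
Qed.

Lemma measurable_fun_rVP (R : realType) d (X : measurableType d) n
    (f : X -> 'rV[R]_n) :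
  measurable_fun [set: X] f <->
  forall i, measurable_fun [set: X] (fun x => f x 0 i).
Proof.
split=> [mf i|mf]; first exact: measurableT_comp (measurable_coord_rV i) mf.
apply: (@measurability _ _ _ _ _ _
  (\big[setU/set0]_(i < n)
     preimage_set_system setT (fun x : 'rV[R]_n => x 0 i) measurable)) => //.
move=> _ [A + <-]; rewrite -bigcup_seq => -[i _ [B mB <-]].
by rewrite setTI; have := mf i measurableT B mB; rewrite !setTI.
Qed.

Section lebesgue_succ.
Context {R : realType} {n : nat}.
Variable mu : {sigma_finite_measure set 'rV[R]_n -> \bar R}.

Definition rV_cons (p : measurableTypeR R * 'rV[R]_n) : 'rV[R]_n.+1 :=
  \row_i oapp (p.2 0) p.1 (unlift ord0 i).

Definition rV_uncons (x : 'rV[R]_n.+1) : measurableTypeR R * 'rV[R]_n :=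
  (x 0 ord0, \row_i x 0 (lift ord0 i)).

Lemma rV_consK : cancel rV_cons rV_uncons.
Proof.
move=> [a x]; congr pair; first by rewrite mxE unlift_none.
by apply/rowP => i; rewrite !mxE liftK.
Qed.

Lemma measurable_rV_cons : measurable_fun setT rV_cons.
Proof.
apply/measurable_fun_rVP => i; under eq_fun do rewrite mxE.
case: unliftP => [j _|_] /=; last exact: measurable_fst.
exact: (measurableT_comp (measurable_coord_rV j) measurable_snd).
Qed.

Lemma measurable_rV_uncons : measurable_fun setT rV_uncons.
Proof.
apply/measurable_fun_pair; first exact: (measurable_coord_rV ord0).
apply/measurable_fun_rVP => i; under eq_fun do rewrite mxE.
exact: measurable_coord_rV.
Qed.

Definition lebesgue_rV_succ : set 'rV[R]_n.+1 -> \bar R :=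
  pushforward (lebesgue_measure \x mu)%E rV_cons.

Let succ0 : lebesgue_rV_succ set0 = 0%E.
Proof. by rewrite /lebesgue_rV_succ /pushforward preimage_set0 measure0. Qed.

Let succ_ge0 A : (0 <= lebesgue_rV_succ A)%E.
Proof. exact: integral_ge0. Qed.

Let succ_sigma_additive : semi_sigma_additive lebesgue_rV_succ.
Proof.
move=> A mA tA mUA; rewrite /lebesgue_rV_succ /pushforward preimage_bigcup.
have mpre B : measurable B -> measurable (rV_cons @^-1` B).
  by move=> mB; rewrite -[X in measurable X]setTI; exact: measurable_rV_cons.
apply: measure_semi_sigma_additive.
- by move=> k; exact: mpre.
- apply/trivIsetP => /= i j _ _ ij; rewrite -preimage_setI.
  by move/trivIsetP : tA => /(_ _ _ _ _ ij) ->//; rewrite preimage_set0.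
- by rewrite -preimage_bigcup; exact: mpre.
Qed.

HB.instance Definition _ := isMeasure.Build _ _ _ lebesgue_rV_succ
  succ0 succ_ge0 succ_sigma_additive.

Let succ_sigma_finite : sigma_finite setT lebesgue_rV_succ.
Proof.
have /sigma_finiteP[A [TA ndA mA]] := sigma_finiteT (@lebesgue_measure R).
have /sigma_finiteP[B [TB ndB mB]] := sigma_finiteT mu.
exists (fun k => rV_uncons @^-1` (A k `*` B k)).
  apply/esym; rewrite -subTset => x _.
  have : setT (rV_uncons x).1 by [].
  have : setT (rV_uncons x).2 by [].
  rewrite TA TB => -[j _ Bj] [i _ Ai]; exists (maxn i j) => //; split.
  - by move: (rV_uncons x).1 Ai; exact/subsetPset/ndA/leq_maxl.
  - by move: (rV_uncons x).2 Bj; exact/subsetPset/ndB/leq_maxr.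
move=> k; have [mAk Ak_fin] := mA k; have [mBk Bk_fin] := mB k; split.
  rewrite -[X in measurable X]setTI; apply: measurable_rV_uncons => //.
  exact: measurableX.
rewrite /lebesgue_rV_succ /pushforward -comp_preimage.
rewrite (_ : rV_uncons \o rV_cons = id); last first.
  by apply/funext => p; exact: rV_consK.
by rewrite preimage_id product_measure1E// lte_mul_pinfty// ge0_fin_numE.
Qed.

HB.instance Definition _ := Measure_isSigmaFinite.Build _ _ _ lebesgue_rV_succ
  succ_sigma_finite.

End lebesgue_succ.

Fixpoint lebesgue_rV {R : realType} (n : nat) :
    {sigma_finite_measure set 'rV[R]_n -> \bar R} :=
  match n with
  | 0 => \d_(0 : 'rV[R]_0)
  | k.+1 => lebesgue_rV_succ (lebesgue_rV k)
  end.
Arguments lebesgue_rV {R} n.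

Section torus.
Context {R : realType} {d : nat}.
Implicit Types (L F x : 'rV[R]_d) (T eta t : R).

(* A field on the torus of side lengths [L] is an [L]-periodic field on R^d,
   integrated over one period. *)
Local Notation vfield := ('rV[R]_d -> 'rV[R]_d).
Local Notation tvfield := (R -> 'rV[R]_d -> 'rV[R]_d).

Definition e_ (j : 'I_d) : 'rV[R]_d := delta_mx 0 j.

Definition periodic (U : Type) L (f : 'rV[R]_d -> U) :=
  forall x j, f (x + L 0 j *: e_ j) = f x.

Definition cell L : set 'rV[R]_d := [set x | forall i, 0 <= x 0 i < L 0 i].

Definition space_int L (f : 'rV[R]_d -> R) : R :=
  \int[lebesgue_rV d]_(x in cell L) f x.

(* C^oo: all iterated directional derivatives are differentiable. *)
Definition smooth (V : normedModType R) (f : V -> R) :=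
  forall (s : seq V) (y : V),
    differentiable (foldr (fun v g => 'D_v g) f s) y.

Definition test_space L : set ('rV[R]_d -> R) :=
  [set phi | smooth phi /\ periodic L phi].

Definition L2norm_sq L (w : vfield) : \bar R :=
  (\int[lebesgue_rV d]_(x in cell L) (\sum_i w x 0 i ^+ 2)%:E)%E.

Definition L2per L (w : vfield) :=
  [/\ periodic L w, measurable_fun setT w & (L2norm_sq L w < +oo)%E].

Definition weak_partial L (j : 'I_d) (w g : vfield) :=
  forall phi, test_space L phi -> forall i,
    space_int L (fun x => w x 0 i * 'D_(e_ j) phi x) =
    - space_int L (fun x => g x 0 i * phi x).

(* A chosen representative of the weak derivative (unique up to a null set). *)
Definition wpartial L (j : 'I_d) (w : vfield) : vfield :=
  xget (fun=> 0) [set g | L2per L g /\ weak_partial L j w g].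

Fixpoint Hper L (k : nat) (w : vfield) : Prop :=
  if k is k'.+1 then
    L2per L w /\ forall j, exists2 g, Hper L k' g & weak_partial L j w g
  else L2per L w.

(* The squared H^k norm; meaningful on [Hper L k] only. *)
Fixpoint Hnorm_sq L (k : nat) (w : vfield) : \bar R :=
  if k is k'.+1 then
    (L2norm_sq L w + \sum_(j < d) Hnorm_sq L k' (wpartial L j w))%E
  else L2norm_sq L w.

Definition ae_time T (P : R -> Prop) :=
  {ae lebesgue_measure, forall t : measurableTypeR R, 0 < t < T -> P t}.

(* Elements of L^2(0,T;H^k_per) are given by jointly measurable
   representatives; for these [t |-> Hnorm_sq L k (u t)] is measurable up to
   modification on a null set. *)
Definition L2_Hper T L (k : nat) (u : tvfield) :=
  [/\ measurable_fun [set p : (measurableTypeR R * 'rV[R]_d)%type | 0 < p.1 < T]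
        (fun p => u p.1 p.2),
      ae_time T (fun t => Hper L k (u t)) &
      (\int[lebesgue_measure]_(t in `]0%R, T[) Hnorm_sq L k (u t) < +oo)%E].

Definition C_Hper T L (k : nat) (u : tvfield) :=
  (forall t, 0 <= t <= T -> Hper L k (u t)) /\
  (forall s, 0 <= s <= T ->
    Hnorm_sq L k (fun x => u t x - u s x) @[t --> within `[0, T] (nbhs s)]
      --> (0 : \bar R)).

Definition zero_mean T L (u : tvfield) :=
  ae_time T (fun t => forall i, space_int L (fun x => u t x 0 i) = 0).

Definition L2_L2per0 T L (v : tvfield) := L2_Hper T L 0 v /\ zero_mean T L v.

Definition div_free T L (u : tvfield) :=
  ae_time T (fun t => forall phi, test_space L phi ->
    space_int L (fun x => \sum_j u t x 0 j * 'D_(e_ j) phi x) = 0).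

(* Equality in L^2(0,T;L^2_per). *)
Definition field_eq T L (v w : tvfield) :=
  ae_time T (fun t =>
    {ae lebesgue_rV d, forall x, cell L x -> v t x = w t x}).

Definition test_time_space T L : set (R * 'rV[R]_d -> R) :=
  [set phi | [/\ smooth phi, (forall t, periodic L (fun x => phi (t, x))) &
    exists a b : R, [/\ 0 < a, b < T &
      forall t x, phi (t, x) != 0 -> a <= t <= b]]].

(* Functionals on functions of (t, x); only their values on
   [test_time_space T L] are significant. *)
Definition distr := (R * 'rV[R]_d -> R) -> R.

Definition distr_of T L (f : R -> 'rV[R]_d -> R) : distr := fun phi =>
  \int[lebesgue_measure]_(t in `]0, T[)
    space_int L (fun x => f t x * phi (t, x)).

Definition distr_dt (S : distr) : distr :=
  fun phi => - S ('D_(1, 0) phi).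

Definition distr_dx (j : 'I_d) (S : distr) : distr :=
  fun phi => - S ('D_(0, e_ j) phi).

Definition distr_laplacian (S : distr) : distr :=
  fun phi => \sum_j distr_dx j (distr_dx j S) phi.

End torus.
Arguments distr R d : clear implicits.

Definition cross2 (R : realType) (u w : 'rV[R]_2) : R :=
  u 0 0 * w 0 1 - u 0 1 * w 0 0.

(* The indices are in the cyclic group of order 3. *)
Definition cross3 (R : realType) (u w : 'rV[R]_3) : 'rV[R]_3 :=
  \row_i (u 0 (i + 1) * w 0 (i + 2%:R) - u 0 (i + 2%:R) * w 0 (i + 1)).

Definition curl2 (R : realType) (S : distr R 2) : 'I_2 -> distr R 2 :=
  fun i phi => if i == 0 then distr_dx 1 S phi else - distr_dx 0 S phi.

Definition curl3 (R : realType) (S : 'I_3 -> distr R 3) : 'I_3 -> distr R 3 :=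
  fun i phi => distr_dx (i + 1) (S (i + 2%:R)) phi
             - distr_dx (i + 2%:R) (S (i + 1)) phi.

(* For d other than 2 and 3 the value is a junk 0. *)
Definition curl_cross (R : realType) (d : nat) (T : R) :
    forall (L : 'rV[R]_d) (v : R -> 'rV[R]_d -> 'rV[R]_d) (F : 'rV[R]_d),
    'I_d -> distr R d :=
  match d with
  | 2 => fun L v F => curl2 (distr_of T L (fun t x => cross2 (v t x) F))
  | 3 => fun L v F =>
      curl3 (fun i => distr_of T L (fun t x => cross3 (v t x) F 0 i))
  | _ => fun _ _ _ _ _ => 0
  end.

Definition induction_eq (R : realType) (d : nat) (T eta : R) (L F : 'rV[R]_d)
    (b v : R -> 'rV[R]_d -> 'rV[R]_d) :=
  forall i phi, test_time_space T L phi ->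
    distr_dt (distr_of T L (fun t x => b t x 0 i)) phi =
    eta * distr_laplacian (distr_of T L (fun t x => b t x 0 i)) phi
    + curl_cross T L v F i phi.

Definition velocity_solution (R : realType) (d : nat) (T eta : R)
    (L F : 'rV[R]_d) (b v : R -> 'rV[R]_d -> 'rV[R]_d) :=
  [/\ L2_L2per0 T L v, div_free T L v,
      induction_eq T eta L F b v & div_free T L b].

Definition lattice_vec (R : realType) (d : nat) (L : 'rV[R]_d)
    (k : 'rV[int]_d) : 'rV[R]_d :=
  \row_i ((k 0 i)%:~R / L 0 i).

Definition incommensurable (R : realType) (d : nat) (L F : 'rV[R]_d) :=
  forall k : 'rV[int]_d, k != 0 -> \sum_i F 0 i * lattice_vec L k 0 i != 0.

(* Main.v *)
(* The difference u of two solutions is divergence-free, has zero mean, and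
   curl (u x F) = (F . grad) u = 0. On the k-th Fourier mode this reads
   (F . g(k)) u_k = 0, so if F is incommensurable then u_k = 0 for k <> 0, while
   u_0 = 0 by the zero mean; completeness of the Fourier modes gives u = 0.
   Conversely, if F . g(k) = 0 for some k <> 0, choose a <> 0 orthogonal to g(k)
   and parallel to F (any a orthogonal to g(k) when F = 0): the shear flow
   a cos(2 pi g(k) . x) has a x F = 0 and can be added to any solution.

   Completeness is proved in L^1, one coordinate at a time by Fubini. In one
   dimension, a function with vanishing Fourier coefficients is orthogonal to
   trigonometric polynomials converging boundedly to the indicator function of
   any given arc, hence vanishes by Lebesgue differentiation. *)

Require Import Defs.
From mathcomp Require Import all_boot all_order all_algebra.
From mathcomp Require Import all_classical all_reals all_analysis.
From mathcomp Require Import measurable_realfun.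
From mathcomp Require Import ring lra zify.

Set Implicit Arguments.
Unset Strict Implicit.
Unset Printing Implicit Defensive.

Import Order.TTheory GRing.Theory Num.Theory.
Import numFieldNormedType.Exports.

Local Open Scope classical_set_scope.
Local Open Scope ring_scope.


(** * Smooth functions *)

(** The induction equation is known only after integration over space and time, so nothing is
    available at a fixed time. It is therefore tested with products of a smooth time cutoff and a
    Fourier mode. Letting the cutoff tend to the indicator of an interval gives a statement about
    each Fourier coefficient at almost every time. The modes are countably many, so one null set of
    times serves them all, and only then does completeness in space apply.

    Subtracting the equations of two solutions with the same [b] leaves algebra on coefficients:
    $(F\cdot g)\,u_k = F\,(g\cdot u_k)$, whose right side vanishes by incompressibility.

    $L^1$ is the class in which the induction on the dimension closes: almost every slice of an
    integrable function is integrable, and the Fourier coefficients of its slices are integrable in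
    the remaining coordinate. The approximating trigonometric polynomials are uniformly bounded, so
    integrability is also all that dominated convergence asks for. *)

Section smooth_functions.
Context {R : realType} {V : normedModType R}.
Implicit Types (f g : V -> R) (v : V).

(** Bounding the order allows induction on it: the derivative of a product is a sum of products of
    functions that are smooth to one order less. *)
Definition smooth_upto n f := forall s : seq V, (size s <= n)%N ->
  forall y, differentiable (foldr (fun v g => 'D_v g) f s) y.

Lemma smooth_uptoS n f : smooth_upto n.+1 f <->
  (forall y, differentiable f y) /\ (forall v, smooth_upto n ('D_v f)).
Proof.
split=> [sf|[df sf] s].
  split=> [y|v s sn y]; first exact: (sf [::]).
  by have := sf (rcons s v); rewrite size_rcons foldr_rcons; apply.
(* [foldr] applies the last entry of the list first, so the innermost derivative is split off at the
   right end. *)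
case/lastP: s => [_ y|s v]; first exact: df.
by rewrite size_rcons foldr_rcons ltnS => sn; exact: sf.
Qed.

Lemma smooth_uptoW n f : smooth_upto n.+1 f -> smooth_upto n f.
Proof. by move=> sf s sn; apply: sf; rewrite leqW. Qed.

Lemma smoothP f : smooth f <-> forall n, smooth_upto n f.
Proof. by split=> [sf n s _ y|sf s y]; [exact: sf|exact: (sf (size s))]. Qed.

Lemma smooth_uptoD n f g :
  smooth_upto n f -> smooth_upto n g -> smooth_upto n (fun x => f x + g x).
Proof.
elim: n f g => [|n IH] f g.
  move=> sf sg [|//] _ y /=.
  by apply: differentiableD; [exact: (sf [::])|exact: (sg [::])].
move=> /smooth_uptoS[df sf] /smooth_uptoS[dg sg]; apply/smooth_uptoS; split.
  by move=> y; apply: differentiableD.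
move=> v; rewrite (_ : 'D_v _ = fun x => 'D_v f x + 'D_v g x); first exact: IH.
by apply/funext => x; rewrite deriveD//; exact: diff_derivable.
Qed.

Lemma smooth_uptoM n f g :
  smooth_upto n f -> smooth_upto n g -> smooth_upto n (fun x => f x * g x).
Proof.
elim: n f g => [|n IH] f g.
  move=> sf sg [|//] _ y /=.
  by apply: differentiableM; [exact: (sf [::])|exact: (sg [::])].
move=> sf0 sg0; have := sf0; have := sg0.
move=> /smooth_uptoS[dg sg] /smooth_uptoS[df sf]; apply/smooth_uptoS; split.
  by move=> y; apply: differentiableM.
move=> v; rewrite (_ : 'D_v _ = fun x => f x * 'D_v g x + g x * 'D_v f x).
  apply: smooth_uptoD; apply: IH => //; exact: smooth_uptoW.
by apply/funext => x; rewrite deriveM//; exact: diff_derivable.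
Qed.

Lemma smoothM f g : smooth f -> smooth g -> smooth (fun x => f x * g x).
Proof. by rewrite !smoothP => sf sg n; exact: smooth_uptoM. Qed.

Lemma derive_comp1 (h : R -> R) (l : V -> R) v x dh :
  is_derive (l x) 1 h dh -> differentiable l x ->
  differentiable (h \o l) x /\ 'D_v (h \o l) x = dh * 'D_v l x.
Proof.
move=> hdh dl; have dfh : differentiable h (l x).
  by apply/derivable1_diffP; exact: ex_derive.
split; first exact: differentiable_comp.
rewrite deriveE; last exact: differentiable_comp.
rewrite diff_comp//= deriveE//.
rewrite -[X in 'd h _ X]mulr1 -[X in X = _]/('d h (l x) ('d l x v *: 1)).
have hv : 'D_1 h (l x) = dh by exact: derive_val.
by rewrite linearZ/= -(deriveE _ dfh) hv /GRing.scale/= mulrC.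
Qed.

(** A directional derivative of [h i \o l] is a constant times [h (next i) \o l], because the
    derivative of [l] in a fixed direction is constant. The induction carries this constant as the
    factor [c]. It serves both the shifted cosines and the flat functions. *)
Lemma smooth_family_affine (I : Type) (next : I -> I) (h : I -> R -> R)
    (l : V -> R) (dl : V -> R) :
  (forall i (x : R), is_derive x 1 (h i) (h (next i) x)) ->
  (forall x, differentiable l x) -> (forall v x, 'D_v l x = dl v) ->
  forall i, smooth (h i \o l).
Proof.
move=> hh lD lE i; apply/smoothP => n.
suff : forall c, smooth_upto n (fun x => c * h i (l x)).
  move/(_ 1); rewrite (_ : (fun _ => _) = h i \o l)//.
  by apply/funext => x; rewrite mul1r.
elim: n i => [|n IH] i c.
  move=> [|//] _ y /=; apply: differentiableM => //.
  by have [] := derive_comp1 0 (hh i (l y)) (lD y).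
apply/smooth_uptoS; split.
  move=> y; apply: differentiableM => //.
  by have [] := derive_comp1 0 (hh i (l y)) (lD y).
move=> v; rewrite (_ : 'D_v _ = fun x => (c * dl v) * h (next i) (l x)).
  exact: IH.
apply/funext => x; have [d1 d2] := derive_comp1 v (hh i (l x)) (lD x).
rewrite deriveM//; last exact: diff_derivable.
by rewrite derive_cst scaler0 addr0 d2 lE /GRing.scale/= mulrAC mulrA.
Qed.

End smooth_functions.

Section flat_function.
Context {R : realType}.
Implicit Types (p : {poly R}) (x : R).

(** The classical function $e^{-1/x}$, with a polynomial factor in $1/x$ that makes the family
    closed under differentiation. *)
Definition flat p x : R := if 0 < x then p.[x^-1] * expR (- x^-1) else 0.

(** With $y=1/x\ge1$ and $n$ the size of [p], $|p(y)|\le Cy^n$ while $e^y\ge y^{n+1}/(n+1)!$; the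
    spare power of $y$ gives the factor $x$. *)
Lemma flat_bound p : exists C, forall x, 0 < x <= 1 -> `|flat p x| <= C * x.
Proof.
pose n := size p; pose C := \sum_(i < n) `|p`_i|.
have Cge0 : 0 <= C by exact: sumr_ge0.
exists (C * n.+1`!%:R) => x /andP[x0 x1]; rewrite /flat x0.
have y1 : 1 <= x^-1 by rewrite invf_ge1.
set y := x^-1 in y1 *; have y0 : 0 < y by rewrite invr_gt0.
have pC : `|p.[y]| <= C * y ^+ n.
  rewrite horner_coef (le_trans (ler_norm_sum _ _ _))// mulr_suml.
  apply: ler_sum => i _; rewrite normrM ler_wpM2l// normrX (gtr0_norm y0).
  by apply: ler_weXn2l => //; exact: ltnW.
rewrite normrM (ger0_norm (expR_ge0 _)) expRN.
have ey : y ^+ n.+1 / n.+1`!%:R <= expR y.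
  by rewrite (le_trans _ (expR_ge1Dxn n (ltW y0)))// lerDr.
rewrite ler_pdivrMr ?expR_gt0// (le_trans pC)//.
have -> : C * n.+1`!%:R * x * expR y = C * (n.+1`!%:R * x * expR y) by ring.
rewrite ler_wpM2l//.
have f0 : (0:R) < n.+1`!%:R by rewrite ltr0n fact_gt0.
rewrite ler_pdivrMr// in ey.
rewrite -[x]invrK -/y mulrAC ler_pdivlMr// mulrC [_%:R * _]mulrC.
by rewrite -exprS.
Qed.

Lemma is_derive_flat p x : is_derive x 1 (flat p) (flat ('X^2 * (p - p^`())) x).
Proof.
have [x0|x0|->] := ltgtP x 0.
- rewrite {2}/flat ltNge (ltW x0)/=.
  apply: near_eq_is_derive (is_derive_cst (0 : R) x 1).
  near=> y; rewrite /flat ifF//; apply/negbTE; rewrite -leNgt ltW//.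
  by near: y; exact: lt_nbhsl.
- rewrite {2}/flat x0.
  have x_neq0 : x != 0 by rewrite gt_eqF.
  have di : is_derive x 1 (fun y : R => y^-1) (- x ^- 2).
    have /= := is_deriveV x_neq0 (is_derive_id x 1).
    by move=> H; apply: is_derive_eq H _; rewrite /GRing.scale/= mulr1.
  have dni : is_derive x 1 (fun y : R => - y^-1) (x ^- 2).
    by apply: (is_derive_eq (is_deriveN di)); rewrite opprK.
  have dp := @is_derive1_comp _ (horner p) GRing.inv x _ _ (is_derive_poly p
    x^-1) di.
  have de := @is_derive1_comp _ expR (fun y =>
    - y^-1) x _ _ (is_derive_expR (- x^-1)) dni.
  have dm := is_deriveM dp de.
  apply: near_eq_is_derive (is_derive_eq dm _).
    near=> y; rewrite /flat ifT//.
    by near: y; exact: lt_nbhsr.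
  by rewrite !hornerE /GRing.scale/= exprVn; ring.
- rewrite {2}/flat ltxx.
  (* For $h>0$ the difference quotient of [flat p] at the origin is [flat ('X * p) h], which the
     linear bound sends to 0; for $h<0$ it is 0. *)
  have [C HC] := flat_bound ('X * p).
  suff H : h^-1 *: (flat p (h *: 1 + 0) - flat p 0) @[h --> 0^'] --> (0 : R).
    by apply: DeriveDef; [apply/cvg_ex; exists 0|exact/cvg_lim].
  apply/cvgr0Pnorm_le => e e0; near=> h.
  rewrite /(flat p 0) ltxx subr0 addr0 /GRing.scale/= mulr1.
  have h0 : h != 0 by near: h; exact: nbhs_dnbhs_neq.
  have [hgt|hle] := ltP 0 h; last by rewrite /flat ltNge hle/= mulr0 normr0 ltW.
  have -> : h^-1 * flat p h = flat ('X * p) h.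
    by rewrite /flat hgt hornerM hornerX mulrA.
  have C1 : 0 < `|C| + 1 by rewrite ltr_wpDl.
  have h1 : h <= 1.
    by rewrite (le_trans (ler_norm _))//; near: h; exact: dnbhs0_le.
  rewrite (le_trans (HC _ _)) ?hgt//.
  rewrite (@le_trans _ _ ((`|C| + 1) * h))//.
    by rewrite ler_wpM2r ?(ltW hgt)// ler_wpDr// ler_norm.
  rewrite mulrC -ler_pdivlMr// (le_trans (ler_norm _))//.
  by near: h; apply: dnbhs0_le; rewrite divr_gt0.
Unshelve. all: end_near. Qed.

End flat_function.

(** * Integration on cells *)

Section product_integral.
Context d1 d2 (T1 : measurableType d1) (T2 : measurableType d2) (R : realType).
Variables (m1 : {sigma_finite_measure set T1 -> \bar R}).
Variables (m2 : {sigma_finite_measure set T2 -> \bar R}).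

(** The inner integral in Fubini's theorem is extended-real and finite only almost everywhere;
    [fine] changes it on a null set only, so real-valued integrals can be iterated. *)
Lemma integrable_fine d (T : measurableType d) (m : {measure set T -> \bar R})
    (D : set T) (F : T -> \bar R) : measurable D -> m.-integrable D F ->
  m.-integrable D (EFin \o (fine \o F)) /\
  (\int[m]_(x in D) (fine (F x))%:E = \int[m]_(x in D) F x)%E.
Proof.
move=> mD iF; have mF := measurable_int _ iF.
have mfF : measurable_fun D (EFin \o (fine \o F : T -> R)).
  by apply/measurable_EFinP;
    exact: measurableT_comp (fine_measurable measurableT) mF.
split.
  apply: (le_integrable mD _ _ iF) => // x _ /=.
  by case: (F x) => [r||] //=; rewrite normr0 leey.
apply: ae_eq_integral => //.
by have := integrable_ae mD iF; apply: filterS => x /[apply] /fineK.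
Qed.

Variables (D1 : set T1) (D2 : set T2) (f : T1 * T2 -> R).
Hypotheses (mD1 : measurable D1) (mD2 : measurable D2).
Hypothesis intf : (m1 \x m2)%E.-integrable (D1 `*` D2) (EFin \o f).

(** Extension by zero reduces Fubini on a rectangle to Fubini on the whole product. *)
Let g := (EFin \o f) \_ (D1 `*` D2).

Let mD : measurable (D1 `*` D2).
Proof. exact: measurableX. Qed.

Let intg : (m1 \x m2)%E.-integrable setT g.
Proof. exact/(integrable_mkcond _ mD).1. Qed.

Let slice1 x : D1 x -> (fun y => g (x, y)) = (EFin \o (fun y =>
  f (x, y))) \_ D2.
Proof.
move=> D1x; apply/funext => y; rewrite /g !patchE.
by congr (if _ then _ else _); apply/idP/idP; rewrite !inE => //= -[].
Qed.

Let slice2 y : D2 y -> (fun x => g (x, y)) = (EFin \o (fun x =>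
  f (x, y))) \_ D1.
Proof.
move=> D2y; apply/funext => x; rewrite /g !patchE.
by congr (if _ then _ else _); apply/idP/idP; rewrite !inE => //= -[].
Qed.

Lemma ae_integrable_slice : {ae m1, forall x, D1 x ->
  m2.-integrable D2 (EFin \o (fun y => f (x, y)))}.
Proof.
have := ae_integrable1 intg; apply: filterS => x + D1x.
by rewrite slice1// => /(integrable_mkcond _ mD2).2.
Qed.

Let F1 : fubini_F m2 g = (fun x => \int[m2]_(y in D2) (f (x, y))%:E)%E \_ D1.
Proof.
apply/funext => x; rewrite /fubini_F patchE; case: ifPn => xD1.
  by rewrite slice1 -?integral_mkcond//; exact/set_mem.
apply: integral0_eq => y _; rewrite /g patchE ifF//; apply/negbTE.
by apply: contra xD1; rewrite !inE => -[].
Qed.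

Let F2 : fubini_G m1 g = (fun y => \int[m1]_(x in D1) (f (x, y))%:E)%E \_ D2.
Proof.
apply/funext => y; rewrite /fubini_G patchE; case: ifPn => yD2.
  by rewrite slice2 -?integral_mkcond//; exact/set_mem.
apply: integral0_eq => x _; rewrite /g patchE ifF//; apply/negbTE.
by apply: contra yD2; rewrite !inE => -[].
Qed.

Let int1 : m1.-integrable D1 (fun x => \int[m2]_(y in D2) (f (x, y))%:E)%E.
Proof.
by apply/(integrable_mkcond _ mD1).2; rewrite -F1; exact: integrable_fubini_F.
Qed.

Let int2 : m2.-integrable D2 (fun y => \int[m1]_(x in D1) (f (x, y))%:E)%E.
Proof.
apply/(integrable_mkcond _ mD2).2; rewrite -F2.

apply/integrableP; split; first exact: (measurable_fubini_G intg).
have /integrableP[mg _] := intg.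
(* The iterated integral of $|g|$ in this order is finite and dominates that of $|\int g|$. *)
apply: le_lt_trans ((integrable21ltyP m1 m2 mg).1 intg).
apply: ge0_le_integral => //.
- by apply: measurableT_comp => //; exact: (measurable_fubini_G intg).
- by apply: (measurable_fun_fubini_tonelli_G (abse \o g)) => //=;
    exact: measurableT_comp.
- by move=> y _; apply: le_abse_integral => //; exact: measurableT_comp.
Qed.

Lemma integrable_Rintegral_slice : m1.-integrable D1
  (EFin \o (fun x => \int[m2]_(y in D2) f (x, y))).
Proof. by have [] := integrable_fine mD1 int1. Qed.

Lemma Rintegral_prod12 : \int[m1]_(x in D1) \int[m2]_(y in D2) f (x, y) =
  Rintegral (m1 \x m2)%E (D1 `*` D2) f.
Proof.
rewrite {1}/Rintegral; congr fine.
rewrite (integrable_fine mD1 int1).2 integral_mkcond -F1.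
by rewrite integral12_prod_meas1// -integral_mkcond.
Qed.

Lemma Rintegral_prod21 : \int[m2]_(y in D2) \int[m1]_(x in D1) f (x, y) =
  Rintegral (m1 \x m2)%E (D1 `*` D2) f.
Proof.
rewrite {1}/Rintegral; congr fine.
rewrite (integrable_fine mD2 int2).2 integral_mkcond -F2.
by rewrite integral21_prod_meas1// -integral_mkcond.
Qed.

End product_integral.

Section row_vectors.
Context {R : realType}.

Lemma measurable_cell n (L : 'rV[R]_n) : measurable (cell L).
Proof.
have -> : cell L = \big[setI/setT]_(i < n)
    ((fun x : 'rV[R]_n => x 0 i) @^-1` `[0, L 0 i[%classic).
  rewrite -bigcap_seq; apply/seteqP; split=> x /= H i.
    by move=> _; rewrite /= in_itv/=; exact: H.
  by have := H i (mem_index_enum _); rewrite /= in_itv.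
apply: bigsetI_measurable => i _; rewrite -[X in measurable X]setTI.
exact: measurable_coord_rV.
Qed.

Lemma mx_norm_le n (x : 'rV[R]_n) e :
  0 <= e -> (forall i, `|x 0 i| <= e) -> `|x| <= e.
Proof.
move=> e0 xe; rewrite -[leLHS]/(mx_norm x) mx_normrE.
by apply: bigmax_le => // -[i j] _ /=; rewrite ord1.
Qed.

(* The sigma-algebra is the product one, so continuous functions are handled
   as pointwise limits of functions of the coordinates rounded to a grid. *)
Lemma continuous_measurable_rV n (f : 'rV[R]_n -> R) :
  continuous f -> measurable_fun setT f.
Proof.
move=> cf.
pose g (m : nat) (z : 'rV[int]_n) : 'rV[R]_n := \row_i ((z 0 i)%:~R / m.+1%:R).
pose r (m : nat) (x : 'rV[R]_n) : 'rV[int]_n :=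
  \row_i Num.floor (m.+1%:R * x 0 i).
apply: (@measurable_fun_cvg _ _ _ _ (fun m => f \o (g m \o r m))); last first.
  move=> x _; apply: (@cvg_comp _ _ _ (fun m => g m (r m x)) f); last exact: cf.
  apply/cvgrPdist_le => e e0; near=> m.
  apply: mx_norm_le => [|i]; first exact: ltW.
  have m0 : (0 : R) < m.+1%:R by [].
  rewrite !mxE; have /andP[h1 h2] := floor_itv (m.+1%:R * x 0 i).
  rewrite intrD in h2.
  have -> : x 0 i - (Num.floor (m.+1%:R * x 0 i))%:~R / m.+1%:R =
     (m.+1%:R * x 0 i - (Num.floor (m.+1%:R * x 0 i))%:~R) / m.+1%:R.
    by field; rewrite gt_eqF.
  rewrite normrM ger0_norm ?subr_ge0// [`|_^-1|]gtr0_norm ?invr_gt0//.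
  rewrite (@le_trans _ _ m.+1%:R^-1)//.
    by rewrite ler_piMl ?invr_ge0 ?ltW//; lra.
  by apply/ltW; near: m; exact: (near_infty_natSinv_lt (PosNum e0)).
move=> m _ Y mY; rewrite setTI.
have -> : (f \o (g m \o r m)) @^-1` Y = \bigcup_z
    (if f (g m z) \in Y then [set x | r m x = z] else set0).
  apply/seteqP; split=> [x Yx|x [z _]]; last first.
    by case: ifPn => //; rewrite inE => Yz /= ->.
  by exists (r m x) => //; rewrite ifT//; rewrite inE.
apply: countable_bigcupT_measurable => // z; case: ifPn => // _.
have -> : [set x | r m x = z] = \big[setI/setT]_(i < n)
    ((fun x : 'rV[R]_n => x 0 i) @^-1`
      `[(z 0 i)%:~R / m.+1%:R, (z 0 i + 1)%:~R / m.+1%:R[%classic).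
  have E (x : 'rV[R]_n) i : (x 0 i \in `[(z 0 i)%:~R / m.+1%:R,
      (z 0 i + 1)%:~R / m.+1%:R[) = (r m x 0 i == z 0 i).
    by rewrite mxE floor_eq in_itv/= ler_pdivrMr// ltr_pdivlMr// [_ * x 0
      i]mulrC.
  rewrite -bigcap_seq; apply/seteqP; split=> x /= H.
    by move=> i _ /=; rewrite E H.
  by apply/rowP => i; apply/eqP; rewrite -E; exact: (H i (mem_index_enum _)).
apply: bigsetI_measurable => i _; rewrite -[X in measurable X]setTI.
exact: measurable_coord_rV.
Unshelve. all: end_near. Qed.

Definition rV_tail n (L : 'rV[R]_n.+1) : 'rV[R]_n := \row_i L 0 (lift ord0 i).

Lemma cell_cons n (L : 'rV[R]_n.+1) : @rV_cons R n @^-1` cell L =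
  `[0, L 0 ord0[%classic `*` cell (rV_tail L).
Proof.
apply/seteqP; split=> -[a x] /=.
  move=> H; split.
    by have := H ord0; rewrite mxE unlift_none/= in_itv.
  by move=> i; have := H (lift ord0 i); rewrite !mxE liftK.
rewrite in_itv/= => -[H1 H2] i; rewrite mxE.
by case: unliftP => [j ->|->] //=; have := H2 j; rewrite mxE.
Qed.

Lemma lebesgue_cell_fin n (L : 'rV[R]_n) : (lebesgue_rV n (cell L) < +oo)%E.
Proof.
elim: n L => [|n IH] L /=; first by rewrite diracE ltry.
rewrite /lebesgue_rV_succ/= /pushforward cell_cons.
rewrite product_measure1E//; last exact: measurable_cell.
rewrite lte_mul_pinfty// ?ge0_fin_numE//= lebesgue_measure_itv/=.
  by case: ifP => _; rewrite ?ltry// -EFinB ltry.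
Qed.

Section succ.
Context {n : nat} (L : 'rV[R]_n.+1) (f : 'rV[R]_n.+1 -> R).
Hypothesis mf : measurable_fun setT f.
Let I : set (measurableTypeR R) := `[0, L 0 ord0[%classic.

Let mfE : measurable_fun setT (EFin \o f).
Proof. exact/measurable_EFinP. Qed.

Lemma integrable_cons : (lebesgue_rV n.+1).-integrable (cell L) (EFin \o f) <->
  (lebesgue_measure \x lebesgue_rV n)%E.-integrable (I `*` cell (rV_tail L))
    (EFin \o (f \o @rV_cons R n)).
Proof.
rewrite -cell_cons; split=> H.
  apply/integrableP; split.
    by apply: measurable_funTS; apply: measurableT_comp mfE _;
      exact: measurable_rV_cons.
  have /integrableP[_] := H.
  rewrite (ge0_integral_pushforward (@measurable_rV_cons R n))//.
    exact: measurable_cell.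
  by apply: measurable_funTS; exact: measurableT_comp.
apply: (integrable_pushforward (@measurable_rV_cons R n) mfE H).
exact: measurable_cell.
Qed.

Lemma Rintegral_cons :
  (lebesgue_rV n.+1).-integrable (cell L) (EFin \o f) ->
  space_int L f = Rintegral (lebesgue_measure \x lebesgue_rV n)%E
   (I `*` cell (rV_tail L)) (f \o @rV_cons R n).
Proof.
move=> /integrable_cons H; rewrite /space_int /Rintegral -cell_cons in H *.
congr fine; rewrite (integral_pushforward (@measurable_rV_cons R n) mfE H)//.
exact: measurable_cell.
Qed.

End succ.

End row_vectors.

(** * Almost-everywhere statements, dominated convergence and Lebesgue points *)

Section almost_everywhere.
Context d (T : measurableType d) (R : realType).
Variable mu : {measure set T -> \bar R}.
Implicit Types P Q : T -> Prop.

Lemma ae_imply P Q : (forall x, P x -> Q x) ->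
  {ae mu, forall x, P x} -> {ae mu, forall x, Q x}.
Proof. by move=> PQ; apply: filterS. Qed.

Lemma ae_and P Q : {ae mu, forall x, P x} -> {ae mu, forall x, Q x} ->
  {ae mu, forall x, P x /\ Q x}.
Proof. exact: filterI. Qed.

(** Used to find one null set valid for all Fourier modes, or for all coordinates, at once. *)
Lemma ae_forall_countable (I : countType) (P : I -> T -> Prop) :
  (forall i, {ae mu, forall x, P i x}) -> {ae mu, forall x, forall i, P i x}.
Proof.
move=> aeP; have : {ae mu, forall x, forall n : nat,
    if unpickle n is Some i then P i x else True}.
  by apply/ae_foralln => n; case: unpickle => [i|]; [exact: aeP|exact: aeW].
by apply: ae_imply => x H i; have := H (pickle i); rewrite pickleK.
Qed.

End almost_everywhere.

Section dominated.
Context d (T : measurableType d) (R : realType).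
Variables (mu : {measure set T -> \bar R}) (D : set T).
Hypothesis mD : measurable D.

Lemma integrableM_bounded (h g : T -> R) (M : R) :
  mu.-integrable D (EFin \o h) -> measurable_fun D g ->
  (forall x, D x -> `|g x| <= M) ->
  mu.-integrable D (EFin \o (fun x => h x * g x)).
Proof.
move=> ih mg gM; have mh : measurable_fun D h.
  by apply/measurable_EFinP; exact: measurable_int ih.
have ihM := integrableZl mD M ih; apply: (le_integrable mD _ _ ihM).
  by apply/measurable_EFinP; exact: measurable_funM.
move=> x Dx /=; rewrite lee_fin !normrM mulrC.
by rewrite ler_wpM2r// (le_trans (gM _ Dx))// ler_norm.
Qed.

(** Dominated convergence with majorant $M|h|$: orthogonality to [h] survives bounded
    almost-everywhere limits. The limits taken later are indicators of intervals. *)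
Lemma Rintegral_cvg0 (h : T -> R) (f_ : nat -> T -> R) (g : T -> R) (M : R) :
  mu.-integrable D (EFin \o h) ->
  (forall n, measurable_fun D (f_ n)) -> measurable_fun D g ->
  (forall n x, D x -> `|f_ n x| <= M) ->
  {ae mu, forall x, D x -> f_ n x @[n --> \oo] --> g x} ->
  (forall n, \int[mu]_(x in D) (h x * f_ n x) = 0) ->
  \int[mu]_(x in D) (h x * g x) = 0.
Proof.
move=> ih mf mg fM fg h0; have mh : measurable_fun D h.
  by apply/measurable_EFinP; exact: measurable_int ih.
have ihM := integrableZl mD M (integrable_abse ih).
have H1 n : measurable_fun D (EFin \o (fun x => h x * f_ n x)).
  by apply/measurable_EFinP; exact: measurable_funM.
have H2 : measurable_fun D (EFin \o (fun x => h x * g x)).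
  by apply/measurable_EFinP; exact: measurable_funM.
have H3 : {ae mu, forall x, D x ->
    (h x * f_ n x)%:E @[n --> \oo] --> (h x * g x)%:E}.
  apply: filterS fg => x /[apply] fgx.
  by apply: cvg_EFin; [exact: nearW|apply: cvgMr].
have H4 : {ae mu, forall x n, D x ->
    (`|(h x * f_ n x)%:E| <= M%:E * `|(h x)%:E|)%E}.
  apply: aeW => x n Dx /=; rewrite lee_fin normrM mulrC.
  by rewrite ler_wpM2r// fM.
have [_ _ H] := dominated_convergence mD H1 H2 H3 ihM H4.
rewrite /Rintegral.
suff -> : (\int[mu]_(x in D) (h x * g x)%:E = 0)%E by [].
apply: (cvg_unique _ H) => //.
rewrite (_ : [sequence _]_n = cst 0%E); first exact: cvg_cst.
apply/funext => n /=; rewrite -[LHS]fineK.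
  by have := h0 n; rewrite /Rintegral => ->.
by apply: integrable_fin_num => //; apply: integrableM_bounded (fM n).
Qed.

End dominated.

Section lebesgue_line.
Context {R : realType}.
Notation mu := (@lebesgue_measure R).

Lemma ae_neq (a : R) : {ae mu, forall x : measurableTypeR R, x != a}.
Proof.
exists [set a]; split => //; first exact: lebesgue_measure_set1.
by move=> x /= /negP; rewrite negbK => /eqP.
Qed.

(** The primitive of [h] has zero increments between points of []l, r[], so it is locally constant
    there; at a Lebesgue point its derivative is [h]. Only intervals strictly inside are tested,
    because the time cutoffs are supported away from 0 and [T]. *)
Lemma ae_zero_itv (h : R -> R) (l r : R) :
  mu.-integrable `]l, r[ (EFin \o h) ->
  (forall a b, l < a -> a < b -> b < r -> \int[mu]_(x in `]a, b[) h x = 0) ->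
  {ae mu, forall x : measurableTypeR R, l < x < r -> h x = 0}.
Proof.
move=> ih h0; pose g := h \_ `]l, r[%classic.
have ig : mu.-integrable setT (EFin \o g).
  rewrite /g -restrict_EFin.
  by apply: (integrable_mkcond _ _).1 ih.
have lg : locally_integrable setT g := open_integrable_locally openT ig.
suff H (x : R) : lebesgue_pt g x -> l < x < r -> h x = 0.
  by apply: ae_imply (lebesgue_differentiation lg) => x; exact: H.
move=> gx /andP[lx xr].
have gE : g x = h x by rewrite /g patchE mem_set//= in_itv/= lx xr.
pose F y := \int[mu]_(t in [set` Interval (BLeft l) (BRight y)]) (g t).
have iS (J : interval R) : mu.-integrable [set` J] (EFin \o g).
  exact: integrableS ig.
have [dF <-//] : derivable F x 1 /\ F^`()%classic x = h x; last first.
  have E : \forall y \near x, F y = cst (F x) y.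
    near=> y.
    have ly : l < y by near: y; exact: lt_nbhsr.
    have yr : y < r by near: y; exact: lt_nbhsl.
    have K y1 y2 : l < y1 -> y1 < y2 -> y2 < r -> F y2 = F y1.
      move=> l1 l2 l3; apply/eqP; rewrite -subr_eq0 /F.
      rewrite Rintegral_itvB ?bnd_simp ?ltW//.
      rewrite -Rintegral_itv_bndo_bndc//.
      rewrite -[X in _ == X](h0 _ _ l1 l2 l3); apply/eqP.
      apply: eq_Rintegral => z; rewrite inE/= in_itv/= => /andP[z1 z2].
      by rewrite /g patchE mem_set//= in_itv/= (lt_trans l1)//= (lt_trans z2).
    by have [yx|xy|->//] := ltgtP y x; [rewrite /= (K y x)|rewrite (K x y)].
  by rewrite derive1E (near_eq_derive _ E) ?derive_cst// oner_eq0.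
have x1 : x < x + 1 by rewrite ltrDl.
have lxb : (l%:E < x%:E)%E by rewrite lte_fin.
have := @FTC1_lebesgue_pt R g (BLeft l) x (x + 1) x1 (iS _).
move=> /(_ lxb gx)[dF FE]; by split => //; rewrite FE.
Unshelve. all: end_near. Qed.

End lebesgue_line.

(** * Completeness of the Fourier modes *)

Section quarter_cosine.
Context {R : realType}.
Implicit Types (m n : int) (x y : R).

(* Cosine shifted by a multiple of a quarter turn: one family, closed under
   differentiation and linearised products, for all cosines and sines. *)
Definition qcos m x : R := cos (x + m%:~R * (pi / 2)).

Lemma qcosM m n x y : qcos m x * qcos n y =
  2^-1 * (qcos (m + n) (x + y) + qcos (m - n) (x - y)).
Proof.
rewrite /qcos intrD intrB.
set a := x + _; set b := y + _.
have -> : x + y + (m%:~R + n%:~R) * (pi / 2) = a + b by rewrite /a /b; lra.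
have -> : x - y + (m%:~R - n%:~R) * (pi / 2) = a - b by rewrite /a /b; lra.
by rewrite cosD cosB; lra.
Qed.

Lemma qcos_le1 m x : `|qcos m x| <= 1.
Proof. exact: cos_max. Qed.

Lemma qcosS m x : qcos (m + 1) x = - sin (x + m%:~R * (pi / 2)).
Proof. by rewrite /qcos intrD mulrDl mul1r addrA cosDpihalf. Qed.

Lemma is_derive_qcos m x : is_derive x 1 (qcos m) (qcos (m + 1) x).
Proof.
rewrite qcosS; apply: is_derive_eq.
by rewrite addr0 mulr1.
Qed.

Lemma continuous_qcos m : continuous (qcos m).
Proof.
move=> x; apply: differentiable_continuous.
by apply/derivable1_diffP; exact: (ex_derive (is_derive := is_derive_qcos m x)).
Qed.

End quarter_cosine.

Lemma bernoulli_ineq (R : realType) (x : R) N : -1 <= x ->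
  1 + N%:R * x <= (1 + x) ^+ N.
Proof.
move=> x1; elim: N => [|N IH]; first by rewrite mul0r addr0 expr0.
rewrite exprS; have x0 : 0 <= 1 + x by lra.
apply: le_trans (ler_wpM2l x0 IH).
have : 0 <= N%:R * x ^+ 2 by rewrite mulr_ge0// sqr_ge0.
by rewrite -natr1 expr2; nra.
Qed.

(* The approximation of a step function used in Brosowski and Deutsch's proof
   of the Stone-Weierstrass theorem. *)
Lemma cvg_step (R : realType) (y : R) : 0 <= y <= 1 -> y != 2^-1 ->
  (1 - y ^+ n) ^+ (2 ^ n) @[n --> \oo] --> (if y < 2^-1 then 1 else 0 : R).
Proof.
move=> /andP[y0 y1] yN.
have yX n : 0 <= y ^+ n <= 1 by rewrite exprn_ge0//= exprn_ile1.
have [yl|yg|/eqP] := ltgtP y 2^-1; last by rewrite (negbTE yN).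
- have C0 : (1 - (2 * y) ^+ n : R) @[n --> \oo] --> (1 - 0 : R).
    apply: cvgB; first exact: cvg_cst.
    by apply: cvg_expr; rewrite ger0_norm ?mulr_ge0//; lra.
  rewrite subr0 in C0.
  apply: (squeeze_cvgr _ C0 (cvg_cst (1 : R))); apply: nearW => n.
  have /andP[z0 z1] := yX n.
  rewrite exprn_ile1 ?andbT; [|lra|lra].
  (* Bernoulli's inequality gives the lower bound $1-2^ny^n=1-(2y)^n$: the exponent $2^n$ is what
     places the threshold at 1/2. *)
  have := @bernoulli_ineq R (- y ^+ n) (2 ^ n).
  by rewrite natrX exprMn mulrN; apply; lra.
- have yp : 0 < y by lra.
  have C0 : ((2 * y)^-1 ^+ n : R) @[n --> \oo] --> (0 : R).
    apply: cvg_expr; rewrite ger0_norm ?invr_ge0 ?mulr_ge0//.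
    by rewrite invf_lt1 ?mulr_gt0//; lra.
  apply: (squeeze_cvgr _ (cvg_cst (0 : R)) C0); apply: nearW => n.
  have /andP[z0 z1] := yX n.
  rewrite exprn_ge0/=; last lra.
  (* With $z=y^n$ and $N=2^n$: since $(1-z)^N(1+z)^N\le1$, the term is at most
     $1/(1+z)^N\le1/(1+Nz)\le(2y)^{-n}$. *)
  have B : 1 + (2 ^ n)%:R * y ^+ n <= (1 + y ^+ n) ^+ (2 ^ n).
    by apply: bernoulli_ineq; lra.
  have K : (1 - y ^+ n) ^+ (2 ^ n) * (1 + y ^+ n) ^+ (2 ^ n) <= 1.
    by rewrite -exprMn exprn_ile1//; nra.
  rewrite exprVn -[leRHS]mul1r ler_pdivlMr ?exprn_gt0 ?mulr_gt0//.
  apply: le_trans K; rewrite ler_wpM2l//; first by rewrite exprn_ge0//; lra.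
  by apply: le_trans B; rewrite natrX exprMn; lra.
Qed.

Section fourier_line.
Context {R : realType}.
Notation mu := (@lebesgue_measure R).
Variables (l : R) (h : R -> R).
Hypothesis l_gt0 : 0 < l.
Let D : set (measurableTypeR R) := `[0, l[%classic.
Hypothesis ih : mu.-integrable D (EFin \o h).

Let mD : measurable D.
Proof. exact: measurable_itv. Qed.

Let theta (k : int) (x : R) := 2 * pi * (k%:~R / l * x).

Let measurable_theta m k : measurable_fun setT (fun x : R =>
  qcos m (theta k x)).
Proof.
apply: continuous_measurable_fun => x.
apply: (@continuous_comp _ _ _ (theta k) (qcos m)); last exact: continuous_qcos.
have -> : theta k = *%R (2 * pi * (k%:~R / l)).
  by apply/funext => y; rewrite /theta mulrA.
exact: mulrl_continuous.
Qed.

(** Asking that [h * g] be orthogonal to every mode, and not only that [g] be orthogonal to [h],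
    makes the class stable under multiplication by modes. Trigonometric polynomials then never need
    an explicit expansion. *)
Let annihilates (g : R -> R) := [/\ measurable_fun setT g,
  exists M : R, forall x, `|g x| <= M &
  forall k m, \int[mu]_(x in D) (h x * (g x * qcos m (theta k x))) = 0].

Let annihilates_integrable g m k : annihilates g ->
  mu.-integrable D (EFin \o (fun x => h x * (g x * qcos m (theta k x)))).
Proof.
move=> [mg [M gM] _]; apply: (@integrableM_bounded _ _ _ _ _ _ _ _ M) => //.
  by apply: measurable_funTS; exact: measurable_funM mg (measurable_theta m k).
move=> x _; rewrite normrM -[M]mulr1 ler_pM//; exact: qcos_le1.
Qed.

Let annihilatesD c1 c2 g1 g2 : annihilates g1 -> annihilates g2 ->
  annihilates (fun x => c1 * g1 x + c2 * g2 x).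
Proof.
move=> H1 H2; have [m1 [M1 b1] z1] := H1; have [m2 [M2 b2] z2] := H2; split.
- exact: measurable_funD (measurable_funM (measurable_cst c1) m1)
    (measurable_funM (measurable_cst c2) m2).
- exists (`|c1| * M1 + `|c2| * M2) => x.
  by rewrite (le_trans (ler_normD _ _))// !normrM lerD// ler_wpM2l.
- move=> k m; transitivity (\int[mu]_(x in D)
      (c1 * (h x * (g1 x * qcos m (theta k x))) +
       c2 * (h x * (g2 x * qcos m (theta k x))))).
    by apply: eq_Rintegral => x _; ring.
  have I1 := annihilates_integrable m k H1.
  have I2 := annihilates_integrable m k H2.
  rewrite RintegralD//;
    [|exact: (integrableZl mD c1 I1)|exact: (integrableZl mD c2 I2)].
  by rewrite !RintegralZl// z1 z2 !mulr0 addr0.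
Qed.

Let annihilatesM g n j : annihilates g ->
  annihilates (fun x => g x * qcos n (theta j x)).
Proof.
move=> H; have [mg [M gM] z] := H; split.
- exact: measurable_funM mg (measurable_theta n j).
- exists M => x; rewrite normrM -[M]mulr1 ler_pM//; exact: qcos_le1.
(* A product of two modes is half the sum of the modes with added and subtracted frequencies and
   shifts. *)
- move=> k m; transitivity (\int[mu]_(x in D) (2^-1 *
      (h x * (g x * qcos (n + m) (theta (j + k) x)) +
       h x * (g x * qcos (n - m) (theta (j - k) x))))).
    apply: eq_Rintegral => x _; rewrite -(mulrA (g x)) qcosM.
    have -> : theta j x + theta k x = theta (j + k) x.
      by rewrite /theta intrD; field; rewrite gt_eqF.
    have -> : theta j x - theta k x = theta (j - k) x.
      by rewrite /theta intrB; field; rewrite gt_eqF.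
    by ring.
  have I1 := annihilates_integrable (n + m) (j + k) H.
  have I2 := annihilates_integrable (n - m) (j - k) H.
  rewrite RintegralZl//; last exact: (integrableD mD I1 I2).
  by rewrite RintegralD// !z addr0 mulr0.
Qed.

(* For [t = cos (pi (b - a) / l)] and [c] the midpoint of [a, b], [arc] takes
   values in [0, 1] and is less than 1/2 exactly on the arc ]a, b[. *)
Let arc (c t x : R) := 2^-1 - (qcos 0 (2 * pi * (x - c) / l) - t) / 4.

Let annihilates_arc c t g : annihilates g ->
  annihilates (fun x => g x * arc c t x).
Proof.
move=> H; pose s := 2 * pi * c / l.
(* The shifted cosine is a combination of the two modes of frequency 1; shift -1 turns the cosine
   into the sine. *)
have E x : qcos 0 (2 * pi * (x - c) / l) =
    cos s * qcos 0 (theta 1 x) + sin s * qcos (-1) (theta 1 x).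
  rewrite /qcos mul0r !addr0 mulN1r cosBpihalf.
  have -> : 2 * pi * (x - c) / l = theta 1 x - s.
    by rewrite /theta /s; field; rewrite gt_eqF.
  by rewrite cosB mulrC [sin _ * _]mulrC.
have -> : (fun x => g x * arc c t x) = fun x =>
   (2^-1 + t / 4) * g x + (-1) *
     ((cos s / 4) * (g x * qcos 0 (theta 1 x)) +
      (sin s / 4) * (g x * qcos (-1) (theta 1 x))).
  by apply/funext => x; rewrite /arc E; field.
apply: (annihilatesD _ _ H).
by apply: annihilatesD; exact: annihilatesM.
Qed.

Let annihilates_arcX c t g n : annihilates g ->
  annihilates (fun x => g x * arc c t x ^+ n).
Proof.
elim: n => [|n IH] H.
  by under eq_fun do rewrite expr0 mulr1.
under eq_fun do rewrite exprSr mulrA.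
by apply: annihilates_arc; exact: IH.
Qed.

Let annihilates_bump c t n N : annihilates (cst 1) ->
  annihilates (fun x => (1 - arc c t x ^+ n) ^+ N).
Proof.
move=> H; elim: N => [|N IH]; first by under eq_fun do rewrite expr0.
have -> : (fun x => (1 - arc c t x ^+ n) ^+ N.+1) = fun x =>
  1 * (1 - arc c t x ^+ n) ^+ N +
  (-1) * ((1 - arc c t x ^+ n) ^+ N * arc c t x ^+ n).
  by apply/funext => x; rewrite exprSr; ring.
by apply: annihilatesD => //; exact: annihilates_arcX.
Qed.

Let arc_itv (t : R) : -1 <= t <= 1 -> forall c x, 0 <= arc c t x <= 1.
Proof.
move=> /andP[t0 t1] c x; rewrite /arc.
by have := qcos_le1 0 (2 * pi * (x - c) / l); rewrite ler_norml; lra.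
Qed.

(** With [al] half the angle of the arc and [be] the angle between [x] and the midpoint, both sides
    of the equivalence say [be < al], as cosine decreases on $[0,\pi]$. The endpoints, where [arc]
    equals 1/2, are excluded. *)
Let arc_lt (a b x : R) : 0 < a -> a < b -> b < l -> 0 <= x < l -> x != a ->
  x != b ->
  let A := arc ((a + b) / 2) (cos (pi * (b - a) / l)) x in
  A != 2^-1 /\ (A < 2^-1) = (a < x < b).
Proof.
move=> a0 ab bl /andP[x0 xl] xa xb.
pose c := (a + b) / 2; pose al := pi * (b - a) / l.
pose be := 2 * pi * `|x - c| / l.
have pi0 := pi_gt0 R.
have beE : qcos 0 (2 * pi * (x - c) / l) = cos be.
  rewrite /qcos mul0r addr0 -[in LHS]cos_norm /be; congr cos.
  by rewrite !normrM normfV normr_nat (gtr0_norm pi0) (gtr0_norm l_gt0).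
have K : (cos al < cos be) = (a < x < b) /\ cos al != cos be; last first.
  move=> /=; rewrite /arc -/c -/al beE; case: K => <- K.
  split; last by apply/idP/idP; lra.
  by apply: contra K => /eqP; move=> K'; apply/eqP; lra.
have xc1 : (a < x < b) = (2 * `|x - c| < b - a).
  apply/idP/idP => [/andP[ax bx]|].
    by rewrite -ltr_pdivlMl// ltr_norml /c; lra.
  by rewrite -ltr_pdivlMl// ltr_norml /c; lra.
have xc2 : 2 * `|x - c| != b - a.
  have [xc|xc] := leP 0 (x - c).
    by rewrite ger0_norm//; apply: contra xb => /eqP; rewrite /c => ?;
      apply/eqP; lra.
  by rewrite ltr0_norm//; apply: contra xa => /eqP; rewrite /c => ?;
    apply/eqP; lra.
have al0 : 0 < al by rewrite /al divr_gt0// mulr_gt0// subr_gt0.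
have alpi : al < pi by rewrite /al ltr_pdivrMr// ltr_pM2l//; lra.
have be0 : 0 <= be by rewrite /be divr_ge0 ?mulr_ge0// ltW.
have ba : (be < al) = (a < x < b).
  rewrite xc1 /be /al ltr_pM2r ?invr_gt0//.
  by rewrite [2 * pi]mulrC -mulrA ltr_pM2l.
have bea : be != al.
  apply: contra xc2 => /eqP; rewrite /be /al => /(mulIf _) H.
  have : 2 * pi * `|x - c| = pi * (b - a) by apply: H; rewrite invr_eq0 gt_eqF.
  by rewrite [2 * pi]mulrC -mulrA => /(mulfI _) -> //; rewrite gt_eqF.
have alin : al \in `[0, pi] by rewrite in_itv/= !ltW.
have [bepi|pibe] := leP be pi.
  have bein : be \in `[0, pi] by rewrite in_itv/= be0.
  rewrite ltr_cos// -ba; split => //.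
  by apply: contra bea => /eqP H; apply/eqP; exact: cos_inj (esym H).
(* Here [x] is more than half a period from the midpoint. The angle is measured the other way round
   as [2 * pi - be], which still exceeds [al] because the arc lies inside one period. *)
have xcl : 2 * `|x - c| + (b - a) < 2 * l.
  have [xc|xc] := leP 0 (x - c); [rewrite ger0_norm//|rewrite ltr0_norm//];
  by rewrite /c; lra.
have beal : be + al < 2 * pi.
  rewrite /be /al -mulrDl ltr_pdivrMr// [2 * pi]mulrC -!mulrA -mulrDr
    ltr_pM2l//.
pose be' := 2 * pi - be.
have cbe : cos be = cos be'.
  rewrite /be' -[in RHS]cosN opprB.
  have -> : be = (be - 2 * pi) + (pi *+ 2) by rewrite mulr2n; lra.
  by rewrite cosD2pi; congr cos; rewrite mulr2n; lra.
have bein : be' \in `[0, pi] by rewrite in_itv/= /be'; lra.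
have albe : al < be' by rewrite /be'; lra.
rewrite cbe ltr_cos// -ba; split; first by apply/idP/idP;
  rewrite /be' in albe *; lra.
by apply/negP => /eqP H; have := cos_inj alin bein H; lra.
Qed.

Lemma fourier_line :
  (forall k m : int, \int[mu]_(x in D) (h x * qcos m (2 * pi * (k%:~R / l *
    x))) = 0) ->
  {ae mu, forall x : measurableTypeR R, 0 <= x < l -> h x = 0}.
Proof.
move=> h0.
have one : annihilates (cst 1).
  split; first exact: measurable_cst.
  - by exists 1 => x; rewrite normr1.
  - by move=> k m; under eq_Rintegral do rewrite mul1r; exact: h0.
have iho : mu.-integrable `]0, l[%classic (EFin \o h).
  apply: integrableS ih => // x.
  by rewrite /D /= !in_itv/= => /andP[x0 xl]; rewrite (ltW x0).
have {}H : {ae mu, forall x : measurableTypeR R, 0 < x < l -> h x = 0}.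
  apply: ae_zero_itv => // a b a0 ab bl.
  pose A : set (measurableTypeR R) := `]a, b[%classic.
  pose c := (a + b) / 2; pose t := cos (pi * (b - a) / l).
  have t1 : -1 <= t <= 1 by rewrite cos_geN1 cos_le1.
  suff : \int[mu]_(x in D) (h x * \1_A x) = 0.
    have sub (x : R) : a < x < b -> 0 <= x < l by lra.
    move=> <-; have -> : `]a, b[%classic = D `&` A.
      apply/seteqP; split=> x; last by case.
      by rewrite /= in_itv => abx; split; rewrite /D /A/= in_itv//; exact: sub.
    rewrite Rintegral_mkcondr; apply: eq_Rintegral => x _.
    by rewrite patchE indicE; case: ifP => _; rewrite ?mulr1 ?mulr0.
  pose f n x := (1 - arc c t x ^+ n) ^+ (2 ^ n).
  have af n : annihilates (f n) by exact: annihilates_bump.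
  apply: (@Rintegral_cvg0 _ _ R mu D mD h f _ 1) => //.
  - by move=> n; have [+ _ _] := af n; exact: measurable_funTS.
  - by apply: measurable_funTS; apply: measurable_indic; exact: measurable_itv.
  - move=> n x _; have /andP[r0 r1] := arc_itv t1 c x.
    rewrite ger0_norm ?exprn_ge0 ?exprn_ile1 ?subr_ge0 ?exprn_ile1//.
    by rewrite lerBlDr lerDl exprn_ge0.
  - apply: ae_imply (ae_and (ae_neq a) (ae_neq b)) => x [xa xb].
    rewrite /D/= in_itv/= => Dx.
    have [Ah AE] := arc_lt a0 ab bl Dx xa xb.
    have := cvg_step (arc_itv t1 c x) Ah; rewrite AE indicE.
    suff -> : (x \in A) = (a < x < b) by case: ifP.
    by apply/idP/idP; rewrite inE /A/= in_itv.
  (* The mode with [k = m = 0] is the constant 1. *)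
  - move=> n; have [_ _ /(_ 0 0)] := af n.
    rewrite /theta /qcos; under eq_Rintegral do
      rewrite !mul0r mulr0 addr0 cos0 mulr1.
    exact.
apply: ae_imply (ae_and H (ae_neq 0)) => x [H1 x0] /andP[xge xl].
by apply: H1; rewrite xl lt_neqAle eq_sym x0 xge.
Qed.

End fourier_line.

Section ae_integral.
Context d (T : measurableType d) (R : realType).
Variables (mu : {measure set T -> \bar R}) (D : set T).
Hypothesis mD : measurable D.

Lemma ae_eq_Rintegral (f g : T -> R) :
  measurable_fun D f -> measurable_fun D g ->
  {ae mu, forall x, D x -> f x = g x} ->
  \int[mu]_(x in D) f x = \int[mu]_(x in D) g x.
Proof.
move=> mf mg fg; rewrite /Rintegral; congr fine.
apply: ae_eq_integral => //; try exact/measurable_EFinP.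
by apply: ae_imply fg => x /[apply] ->.
Qed.

Lemma Rintegral_norm_eq0 (f : T -> R) : mu.-integrable D (EFin \o f) ->
  \int[mu]_(x in D) `|f x| = 0 -> {ae mu, forall x, D x -> f x = 0}.
Proof.
move=> fi f0; have mf := measurable_int _ fi.
have : ae_eq mu D (EFin \o f) (cst 0%E).
  apply/ae_eq_integral_abs => //; rewrite -[LHS]fineK ?f0//.
    by move: f0; rewrite /Rintegral => ->.
  exact: integrable_fin_num (integrable_norm fi).
by apply: ae_imply => x /[apply] -[].
Qed.

End ae_integral.

Section modes.
Context {R : realType}.

Definition phase n (L : 'rV[R]_n) (k : 'rV[int]_n) (x : 'rV[R]_n) : R :=
  2 * pi * \sum_i lattice_vec L k 0 i * x 0 i.

Definition mode n (L : 'rV[R]_n) k m (x : 'rV[R]_n) := qcos m (phase L k x).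

Lemma entry_le_norm n (x : 'rV[R]_n) i : `|x 0 i| <= `|x|.
Proof.
rewrite -[leRHS]/(mx_norm x) mx_normrE.
exact: (le_bigmax _ (fun ij => `|x ij.1 ij.2|) (0, i)).
Qed.

Lemma continuous_coord n (i : 'I_n) : continuous (fun x : 'rV[R]_n => x 0 i).
Proof.
exact: coord_continuous.
Qed.

Lemma continuous_phase n (L : 'rV[R]_n) k : continuous (phase L k).
Proof.
have S : continuous (fun x : 'rV[R]_n => \sum_i lattice_vec L k 0 i * x 0 i).
  apply: continuous_big => [|i _ x]; first exact: add_continuous.
  exact: cvgMl_tmp (@continuous_coord _ i x).
by move=> x; exact: cvgMl_tmp (S x).
Qed.

Lemma continuous_mode n (L : 'rV[R]_n) k m : continuous (mode L k m).
Proof.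
move=> x; apply: (@continuous_comp _ _ _ (phase L k) (qcos m)).
  exact: continuous_phase.
exact: continuous_qcos.
Qed.

Lemma measurable_mode n (L : 'rV[R]_n) k m : measurable_fun setT (mode L k m).
Proof. exact: continuous_measurable_rV (@continuous_mode _ _ _ _). Qed.

Lemma mode_le1 n (L : 'rV[R]_n) k m x : `|mode L k m x| <= 1.
Proof. exact: qcos_le1. Qed.

Definition cons_int n (k0 : int) (k : 'rV[int]_n) : 'rV[int]_n.+1 :=
  \row_i oapp (k 0) k0 (unlift ord0 i).

Lemma phase_cons n (L : 'rV[R]_n.+1) k0 k a y :
  phase L (cons_int k0 k) (rV_cons (a, y)) =
  2 * pi * (k0%:~R / L 0 ord0 * a) + phase (rV_tail L) k y.
Proof.
rewrite /phase big_ord_recl -mulrDr; congr (_ * (_ + _)).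
  by rewrite !mxE unlift_none.
by apply: eq_bigr => i _; rewrite !mxE liftK.
Qed.

Lemma phaseN n (L : 'rV[R]_n) k x : phase L (- k) x = - phase L k x.
Proof.
rewrite /phase -mulrN -sumrN; congr (_ * _); apply: eq_bigr => i _.
by rewrite !mxE intrN !mulNr.
Qed.

(** Induction on the dimension. Each Fourier coefficient [g k m] of the slices at first coordinate
    [a] vanishes for almost every [a] by the one-dimensional case. Countability makes this
    simultaneous in [k] and [m], and the induction hypothesis kills almost every slice. *)
Theorem fourier_cell n (L : 'rV[R]_n) (f : 'rV[R]_n -> R) :
  (forall i, 0 < L 0 i) -> measurable_fun setT f ->
  (lebesgue_rV n).-integrable (cell L) (EFin \o f) ->
  (forall k m, space_int L (fun x => f x * mode L k m x) = 0) ->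
  {ae lebesgue_rV n, forall x, cell L x -> f x = 0}.
Proof.
elim: n L f => [|n IH] L f L0 mf fi f0.
  (* In dimension 0 the measure is a Dirac mass and this mode is 1, so the hypothesis reads
     [f 0 = 0]. *)
  have := f0 0 0; rewrite /space_int /Rintegral integral_dirac//; last 2 first.
  - exact: measurable_cell.
  - apply/measurable_EFinP/measurable_funTS/measurable_funM => //.
    exact: measurable_mode.
  rewrite diracE mem_set ?mul1e/=; last by case.
  rewrite /mode /phase big_ord0 /qcos mulr0 mul0r addr0 cos0 mulr1 => f00.
  by apply: aeW => x _; rewrite [x]thinmx0.
have L0' i : 0 < rV_tail L 0 i by rewrite mxE.
pose I : set (measurableTypeR R) := `[0, L 0 ord0[%classic.
have mI : measurable I by exact: measurable_itv.
have mC := measurable_cell (rV_tail L).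
pose fc := f \o @rV_cons R n.
have ific := (integrable_cons L mf).1 fi.
have ifm k m : (lebesgue_measure \x lebesgue_rV n)%E.-integrable
    (I `*` cell (rV_tail L)) (EFin \o (fun p =>
      fc p * mode (rV_tail L) k m p.2)).
  apply: (@integrableM_bounded _ _ _ _ _ _ _ _ 1) => //.
  - exact: measurableX.
  - apply: measurable_funTS.
    exact: measurableT_comp (measurable_mode _ _ _) measurable_snd.
  - by move=> x _; exact: mode_le1.
have ifM k m : (lebesgue_rV n.+1).-integrable (cell L)
    (EFin \o (fun x => f x * mode L k m x)).
  apply: (@integrableM_bounded _ _ _ _ _ _ _ _ 1) => //.
  - exact: measurable_cell.
  - by apply: measurable_funTS; exact: measurable_mode.
  - by move=> x _; exact: mode_le1.
pose g k m a := \int[lebesgue_rV n]_(y in cell (rV_tail L))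
  (fc (a, y) * mode (rV_tail L) k m y).
have ig k m : lebesgue_measure.-integrable I (EFin \o g k m).
  exact: (integrable_Rintegral_slice mI mC (ifm k m)).
have g0 k m : {ae lebesgue_measure, forall a : measurableTypeR R,
    0 <= a < L 0 ord0 -> g k m a = 0}.
  apply: fourier_line => // k0 m0.
  have mfM k' m' : measurable_fun setT (fun x => f x * mode L k' m' x).
    by apply: measurable_funM => //; exact: measurable_mode.
  have icM k' m' := (integrable_cons L (mfM k' m')).1 (ifM k' m').
  have int2 k' m' : \int[lebesgue_measure]_(a in I)
      \int[lebesgue_rV n]_(y in cell (rV_tail L))
        (fc (a, y) * mode L k' m' (rV_cons (a, y))) = 0.
    rewrite -(f0 k' m') (Rintegral_cons (mfM k' m') (ifM k' m')).
    by rewrite -(Rintegral_prod12 mI mC (icM k' m')).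
  have isl k' m' : lebesgue_measure.-integrable I (EFin \o (fun a =>
      \int[lebesgue_rV n]_(y in cell (rV_tail L))
        (fc (a, y) * mode L k' m' (rV_cons (a, y))))).
    exact: (integrable_Rintegral_slice mI mC (icM k' m')).
  (* Real modes do not factor over coordinates: the product of a mode in [a] and one in [y] is the
     half-sum of two full modes, of frequencies [(k0, k)] and [(k0, - k)]. *)
  pose q a := qcos m0 (2 * pi * (k0%:~R / L 0 ord0 * a)).
  pose G1 a := \int[lebesgue_rV n]_(y in cell (rV_tail L))
        (fc (a, y) * mode L (cons_int k0 k) (m0 + m) (rV_cons (a, y))).
  pose G2 a := \int[lebesgue_rV n]_(y in cell (rV_tail L))
        (fc (a, y) * mode L (cons_int k0 (- k)) (m0 - m) (rV_cons (a, y))).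
  transitivity (\int[lebesgue_measure]_(a in I) (2^-1 * (G1 a + G2 a))).
    apply: ae_eq_Rintegral => //.
    - apply: measurable_funM; first by apply/measurable_EFinP;
      exact: measurable_int (ig k m).
      apply: measurable_funTS; apply: continuous_measurable_fun => a.
      apply: (@continuous_comp _ _ _ (fun a =>
        2 * pi * (k0%:~R / L 0 ord0 * a)) (qcos m0)).
        rewrite (_ : (fun _ => _) = *%R (2 * pi * (k0%:~R / L 0 ord0))).
          exact: mulrl_continuous.
        by apply/funext => z; rewrite mulrA.
      exact: continuous_qcos.
    - apply: measurable_funM => //; apply: measurable_funD.
        by apply/measurable_EFinP; exact: measurable_int (isl _ _).
      by apply/measurable_EFinP; exact: measurable_int (isl _ _).
    have := ae_and (ae_integrable_slice mI mC (icM (cons_int k0 k) (m0 + m)))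
      (ae_and (ae_integrable_slice mI mC (icM (cons_int k0 (- k)) (m0 - m)))
              (ae_integrable_slice mI mC (ifm k m))).
    apply: ae_imply => a [i1 [i2 i3]] Ia.
    rewrite /G1 /G2 -RintegralD//; [|exact: i1|exact: i2].
    rewrite -[LHS]RintegralZr//; last exact: i3.
    rewrite -[RHS]RintegralZl//; last exact: integrableD (i1 Ia) (i2 Ia).
    apply: eq_Rintegral => y _; rewrite /mode !phase_cons phaseN.
    by rewrite -mulrA [qcos m _ * _]mulrC qcosM; ring.
  rewrite RintegralZl//; last exact: integrableD (isl _ _) (isl _ _).
  by rewrite RintegralD//; [rewrite !int2 addr0 mulr0|exact: isl|exact: isl].
have : {ae lebesgue_measure, forall a : measurableTypeR R, I a ->
    {ae lebesgue_rV n, forall y, cell (rV_tail L) y -> fc (a, y) = 0}}.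
  have := ae_and (ae_integrable_slice mI mC ific)
    (ae_forall_countable (fun p : 'rV[int]_n * int => g0 p.1 p.2)).
  apply: ae_imply => a [iy gy] Ia; apply: IH => //.
  - apply: measurableT_comp mf _;
    apply: measurableT_comp (@measurable_rV_cons R n) _.
    exact: measurable_pair1.
  - exact: iy.
  - by move=> k m; apply: (gy (k, m)); move: Ia; rewrite /I/= in_itv.
(* The iterated integral of $|f|$ turns vanishing on almost every slice into vanishing almost
   everywhere on the cell. *)
move=> fc0; apply: Rintegral_norm_eq0 => //; first exact: measurable_cell.
have nfi : (lebesgue_rV n.+1).-integrable (cell L) (EFin \o (Num.norm \o f)).
  exact: integrable_norm.
have mnf : measurable_fun setT (Num.norm \o f) by exact: measurableT_comp.
rewrite -[LHS]/(space_int L (Num.norm \o f)) (Rintegral_cons mnf nfi).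
have infc := (integrable_cons L mnf).1 nfi.
rewrite -(Rintegral_prod12 mI mC infc).
have ins := integrable_Rintegral_slice mI mC infc.
transitivity (\int[lebesgue_measure]_(a in I) (0 : R)); last first.
  by rewrite Rintegral_cst// mul0r.
apply: ae_eq_Rintegral => //; first by apply/measurable_EFinP;
  exact: measurable_int ins.
have := ae_and (ae_integrable_slice mI mC infc) fc0.
apply: ae_imply => a [ia fca] Ia.
transitivity (\int[lebesgue_rV n]_(y in cell (rV_tail L)) (0 : R)); last first.
  by rewrite Rintegral_cst// mul0r.
apply: ae_eq_Rintegral => //.
  by apply/measurable_EFinP; exact: measurable_int (ia Ia).
apply: ae_imply (fca Ia) => y fy /fy fay /=.
by rewrite -[X in `|X|]/(fc (a, y)) fay normr0.
Qed.

End modes.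

(** * Integrals of partial derivatives *)

Section cell_calculus.
Context {R : realType}.

Lemma rV_consE n (a b : R) (x y : 'rV[R]_n) h :
  h *: rV_cons (a, x) + rV_cons (b, y) = rV_cons (h * a + b, h *: x + y).
Proof. by apply/rowP => i; rewrite !mxE; case: unliftP => [j|] /=;
  rewrite ?mxE. Qed.

Lemma e_0 n : e_ (ord0 : 'I_n.+1) = rV_cons (1, 0) :> 'rV[R]_n.+1.
Proof.
by apply/rowP => i; rewrite !mxE /=; case: unliftP => [j ->|->] /=;
  rewrite ?mxE.
Qed.

Lemma e_lift n (j : 'I_n) : e_ (lift ord0 j) = rV_cons (0, e_ j) :> 'rV[R]_n.+1.
Proof.
apply/rowP => i; rewrite !mxE /=; case: unliftP => [k ->|->] //=.
by rewrite !mxE /= (inj_eq (@lift_inj _ ord0)).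
Qed.

Lemma rV_cons_norm_le n (a : R) (x : 'rV[R]_n) e : 0 <= e ->
  `|a| <= e -> `|x| <= e -> `|rV_cons (a, x)| <= e.
Proof.
move=> e0 ae xe; apply: mx_norm_le => // i; rewrite mxE.
by case: unliftP => //= j _; apply: le_trans (entry_le_norm _ _) xe.
Qed.

Lemma rV_consB n (a b : R) (x y : 'rV[R]_n) :
  rV_cons (a, x) - rV_cons (b, y) = rV_cons (a - b, x - y).
Proof. by apply/rowP => i; rewrite !mxE; case: unliftP => [j|] /=;
  rewrite ?mxE. Qed.

Lemma continuous_rV_consr n (a : R) : continuous (fun y : 'rV[R]_n =>
  rV_cons (a, y)).
Proof.
move=> y; apply/(@cvgrPdist_le _ _ _ (nbhs y) (nbhs_filter y)) => e e0;
  near=> z.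
rewrite rV_consB subrr; apply: rV_cons_norm_le; first exact: ltW.
  by rewrite normr0 ltW.
by near: z; apply: (@cvgr_dist_le _ _ _ (nbhs y) (nbhs_filter y) id y).
Unshelve. all: end_near. Qed.

Lemma continuous_rV_consl n (y : 'rV[R]_n) : continuous (fun a : R =>
  rV_cons (a, y)).
Proof.
move=> a; apply/cvgrPdist_le => e e0; near=> z.
rewrite rV_consB subrr; apply: rV_cons_norm_le; first exact: ltW.
  by near: z; apply: (@cvgr_dist_le _ _ _ (nbhs a) (nbhs_filter a) id a).
by rewrite normr0 ltW.
Unshelve. all: end_near. Qed.

Lemma continuous_bounded_cell n (L : 'rV[R]_n) (f : 'rV[R]_n -> R) :
  continuous f -> exists M, forall x, cell L x -> `|f x| <= M.
Proof.
move=> cf; pose K := [set x :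
  'rV[R]_n | forall i, `[0, L 0 i]%classic (x ord0 i)].
have cK : compact K.
  apply: (@rV_compact R n (fun i => `[0, L 0 i]%classic)) => i.
  exact: segment_compact.
have : compact (f @` K) by apply: continuous_compact => //;
  exact: continuous_subspaceT.
move=> /compact_bounded[M [_ MK]]; exists (M + 1) => x Lx.
apply: (MK (M + 1)); first by rewrite ltrDl.
exists x => // i /=; rewrite in_itv/=.
by have /andP[-> /ltW] := Lx i.
Qed.

Lemma continuous_integrable_cell n (L : 'rV[R]_n) (f : 'rV[R]_n -> R) :
  continuous f -> (lebesgue_rV n).-integrable (cell L) (EFin \o f).
Proof.
move=> cf; have [M fM] := continuous_bounded_cell L cf.
apply: measurable_bounded_integrable.
- exact: measurable_cell.
- exact: lebesgue_cell_fin.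
- by apply: measurable_funTS; exact: continuous_measurable_rV.
- exists M; split; first exact: num_real.
  by move=> N MN x Lx /=; exact: le_trans (fM _ Lx) (ltW MN).
Qed.

(** A directional derivative depends only on the restriction to one line, so it passes to slices and
    product spaces without any chain rule. *)
Lemma is_derive_transport (V W : normedModType R) (F : W -> R) (f : V -> R)
    (x v : V) (z w : W) (df : R) :
  (forall h : R, f (h *: v + x) = F (h *: w + z)) ->
  is_derive z w F df -> is_derive x v f df.
Proof.
move=> fF [dF Fdf].
have E : (fun h : R => h^-1 *: (f (h *: v + x) - f x)) =
         (fun h : R => h^-1 *: (F (h *: w + z) - F z)).
  apply/funext => h; have := fF 0; rewrite !scale0r !add0r => ->.
  by rewrite fF.
apply: DeriveDef; first by rewrite /derivable E.
by rewrite /derive E.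
Qed.

(** The fundamental theorem of calculus in the variable [j], with boundary values equal by
    periodicity. If [j] is not the first coordinate, the induction hypothesis applies on slices; if
    it is, the other order of integration is used. *)
Lemma space_int_partial n (L : 'rV[R]_n) (F G : 'rV[R]_n -> R) (j : 'I_n) :
  (forall i, 0 < L 0 i) -> Defs.periodic L F -> continuous G ->
  (forall x : 'rV[R]_n, is_derive x (e_ j) F (G x)) -> space_int L G = 0.
Proof.
elim: n L F G j => [L F G [[]]|n IH L F G j L0 pF cG dF] //.
have mG := continuous_measurable_rV cG.
have iG := continuous_integrable_cell L cG.
pose I : set (measurableTypeR R) := `[0, L 0 ord0[%classic.
have mI : measurable I by exact: measurable_itv.
have mC := measurable_cell (rV_tail L).
have icG := (integrable_cons L mG).1 iG.
rewrite (Rintegral_cons mG iG).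
move: dF; case: (unliftP ord0 j) => [j' ->|->] dF.
  rewrite -(Rintegral_prod12 mI mC icG).
  transitivity (\int[lebesgue_measure]_(a in I) (0 : R)); last first.
    by rewrite Rintegral_cst// mul0r.
  apply: eq_Rintegral => a _.
  apply: (IH (rV_tail L) (fun y => F (rV_cons (a, y))) (fun y =>
    G (rV_cons (a, y))) j').
  - by move=> i; rewrite mxE.
  - move=> y i; rewrite -(pF (rV_cons (a, y)) (lift ord0 i)) mxE.
    by rewrite e_lift ![_ + _ *: _]addrC rV_consE mulr0 add0r.
  - move=> y; apply: (@continuous_comp _ _ _ (fun y => rV_cons (a, y)) G).
      exact: continuous_rV_consr.
    exact: cG.
  - move=> y; apply: is_derive_transport (dF (rV_cons (a, y))) => h.
    by rewrite e_lift rV_consE mulr0 add0r.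
rewrite -(Rintegral_prod21 mI mC icG).
transitivity (\int[lebesgue_rV n]_(y in cell (rV_tail L)) (0 : R)); last first.
  by rewrite Rintegral_cst// mul0r.
apply: eq_Rintegral => y _.
pose f a := F (rV_cons (a, y)); pose g a := G (rV_cons (a, y)).
have df a : is_derive a (1 : R) f (g a).
  apply: is_derive_transport (dF (rV_cons (a, y))) => h.
  by rewrite e_0 rV_consE scaler0 add0r /f /GRing.scale/=.
have cg : continuous g.
  move=> a; apply: (@continuous_comp _ _ _ (fun a => rV_cons (a, y)) G).
    exact: continuous_rV_consl.
  exact: cG.
have cf : continuous f.
  by move=> a; apply: differentiable_continuous; apply/derivable1_diffP;
    exact: ex_derive.
have ig : lebesgue_measure.-integrable `[0, L 0 ord0]%classic (EFin \o g).
  apply: continuous_compact_integrable; first exact: segment_compact.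
  exact: continuous_subspaceT.
rewrite -[LHS]/(\int[lebesgue_measure]_(a in `[0, L 0 ord0[) g a).
rewrite Rintegral_itv_bndo_bndc; last first.
  apply: integrableS ig => // a /=; rewrite !in_itv/= => /andP[-> h].
  by rewrite ltW.
rewrite /Rintegral (continuous_FTC2 (F := f) (L0 ord0)).
- have E : F (rV_cons (L 0 ord0, y)) = F (rV_cons (0, y)).
    rewrite -(pF (rV_cons (0, y)) ord0) e_0 [rV_cons (0, y) + _]addrC rV_consE.
    by rewrite mulr1 addr0 scaler0 add0r.
  by rewrite /f E -EFinB subrr.
- exact: continuous_subspaceT.
- split.
  + by move=> a _; exact: ex_derive.
  + exact: cvg_at_right_filter (cf _).
  + exact: cvg_at_left_filter (cf _).
- by move=> a _; rewrite derive1E; exact: derive_val.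
Qed.

End cell_calculus.

(** * Test functions *)

Section test_functions.
Context {R : realType}.

Lemma is_derive_affine (V : normedModType R) (f : V -> R) (x v : V) c :
  (forall h, f (h *: v + x) = f x + h * c) -> is_derive x v f c.
Proof.
move=> fc.
have dF : is_derive (0 : R) (1 : R) (cst (f x) + c *: id : R -> R) c.
  have := is_deriveD (is_derive_cst (f x) (0 : R) (1 :
    R)) (is_deriveZ c (is_derive_id (0 : R) (1 : R))).
  by rewrite add0r /GRing.scale/= mulr1.
apply: is_derive_transport dF => h.
by rewrite fc addr0 !fctE /GRing.scale/= mulr1 mulrC.
Qed.

Lemma phaseD n (L : 'rV[R]_n) k (x y : 'rV[R]_n) h :
  phase L k (h *: x + y) = h * phase L k x + phase L k y.
Proof.
rewrite /phase mulrCA -mulrDr; congr (_ * _).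
rewrite mulr_sumr -big_split; apply: eq_bigr => i _ /=.
by rewrite !mxE; ring.
Qed.

Lemma phase_e n (L : 'rV[R]_n) k j :
  phase L k (e_ j) = 2 * pi * lattice_vec L k 0 j.
Proof.
rewrite /phase; congr (_ * _); rewrite (bigD1 j)//= big1 ?addr0.
  by rewrite !mxE !eqxx mulr1.
by move=> i ij; rewrite !mxE (negbTE ij) mulr0.
Qed.

Lemma qcosDz m s (z : int) : qcos m (s + 2 * pi * z%:~R) = qcos m s :> R.
Proof.
have per i x : cos (x + 2 * pi * i%:R) = cos x :> R.
  rewrite -[RHS](periodicn (@cosD2pi R) i); congr (cos (_ + _)).
  by rewrite [RHS]mulrnAC -[pi *+ i]mulr_natr -[RHS]mulr_natl mulrA.
rewrite /qcos; set r := _ * (pi / 2).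
case: z => [i|i]; first by rewrite addrAC; exact: per.
rewrite NegzE -[LHS](per i.+1) intrN mulrN -pmulrn; congr cos.
by rewrite addrAC subrK.
Qed.

Lemma periodic_mode n (L : 'rV[R]_n) k m : (forall i, 0 < L 0 i) ->
  Defs.periodic L (mode L k m).
Proof.
move=> L0 x j; rewrite /mode addrC phaseD phase_e mxE.
rewrite [_ + phase _ _ _]addrC (_ : _ * _ = 2 * pi * (k 0 j)%:~R) ?qcosDz//.
by field; rewrite gt_eqF.
Qed.

Lemma differentiable_phase n (L : 'rV[R]_n) k x : differentiable (phase L k) x.
Proof.
have -> : phase L k = (2 * pi) *: \sum_(i < n)
    (lattice_vec L k 0 i *: (fun x : 'rV[R]_n => x 0 i)).
  by apply/funext => y; rewrite /phase /GRing.scale/= fct_sumE.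
apply: differentiableZ; apply: differentiable_sum => i.
by apply: differentiableZ; exact: differentiable_coord.
Qed.

Lemma is_derive_phase n (L : 'rV[R]_n) k x v :
  is_derive x v (phase L k) (phase L k v).
Proof. by apply: is_derive_affine => h; rewrite phaseD addrC. Qed.

Lemma derive_mode n (L : 'rV[R]_n) k m x v :
  differentiable (mode L k m) x /\
  'D_v (mode L k m) x = phase L k v * mode L k (m + 1) x.
Proof.
have [d1 d2] := derive_comp1 v (is_derive_qcos m (phase L k x))
  (differentiable_phase L k x).
split; first exact: d1.
rewrite -[LHS]/('D_v (qcos m \o phase L k) x) d2 mulrC.
by rewrite (@derive_val _ _ _ _ _ _ _ (is_derive_phase L k x v)).
Qed.

Lemma smooth_mode n (L : 'rV[R]_n) k m : smooth (mode L k m).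
Proof.
apply: (@smooth_family_affine _ _ _ (fun j =>
  j + 1) qcos (phase L k) (phase L k)).
- exact: is_derive_qcos.
- exact: differentiable_phase.
- by move=> v x; exact: (@derive_val _ _ _ _ _ _ _ (is_derive_phase L k x v)).
Qed.

Lemma test_space_mode n (L : 'rV[R]_n) k m : (forall i, 0 < L 0 i) ->
  test_space L (mode L k m).
Proof. by move=> L0; split; [exact: smooth_mode|exact: periodic_mode]. Qed.

Lemma flat1_itv (x : R) : 0 <= flat 1 x <= 1.
Proof.
rewrite /flat; case: ifP => x0; last by rewrite lexx ler01.
by rewrite hornerC mul1r expR_ge0 expR_le1 oppr_le0 invr_ge0 ltW.
Qed.

Lemma continuous_flat p : continuous (flat p : R -> R).
Proof.
move=> x; apply: differentiable_continuous; apply/derivable1_diffP.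
by have [] := is_derive_flat p x.
Qed.

Lemma cvg_flat1 (s : R) :
  flat 1 (n.+1%:R * s) @[n --> \oo] --> (if 0 < s then 1 else 0 : R).
Proof.
case: ifP => s0; last first.
  rewrite (_ : (fun _ => _) = cst 0); first exact: cvg_cst.
  by apply/funext => n; rewrite /flat pmulr_rgt0// s0.
have H : (- (s^-1 * n.+1%:R^-1) : R) @[n --> \oo] --> (- (s^-1 * 0) : R).
  by apply: cvgN; apply: cvgMl_tmp; exact: cvg_harmonic.
rewrite mulr0 oppr0 in H.
rewrite -[X in _ --> X](@expR0 R);
  have := cvg_comp _ _ H (@continuous_expR R 0).
apply: cvg_trans; apply: near_eq_cvg; apply: nearW => n.
by rewrite /flat pmulr_rgt0// s0 hornerC mul1r invfM mulrC.
Qed.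

(** For $a<t<b$ this is $e^{-1/((n+1)(t-a))}\,e^{-1/((n+1)(b-t))}$. It tends to 1 there while the
    support stays in $[a,b]$ for all [n], so every term is an admissible time cutoff. *)
Definition smooth_bump (a b : R) (n : nat) (t : R) : R :=
  flat 1 (n.+1%:R * (t - a)) * flat 1 (n.+1%:R * (b - t)).

Lemma bump_le1 a b n t : `|smooth_bump a b n t| <= 1.
Proof.
have /andP[a0 a1] := flat1_itv (n.+1%:R * (t - a)).
have /andP[b0 b1] := flat1_itv (n.+1%:R * (b - t)).
by rewrite ger0_norm ?mulr_ge0// mulr_ile1.
Qed.

Lemma bump_support a b n t : smooth_bump a b n t != 0 -> a <= t <= b.
Proof.
rewrite mulf_eq0 negb_or /flat !pmulr_rgt0// !subr_gt0.
by case: ifP => [/ltW ->|]; rewrite ?eqxx//; case: ifP => [/ltW ->|];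
  rewrite ?eqxx ?andbF.
Qed.

Lemma cvg_bump a b t :
  smooth_bump a b n t @[n --> \oo] --> (\1_(`]a, b[%classic) t : R).
Proof.
have -> : (\1_(`]a, b[%classic) t : R) =
    (if 0 < t - a then 1 else 0) * (if 0 < b - t then 1 else 0).
  rewrite indicE !subr_gt0 (_ : (t \in `]a, b[%classic) = (a < t) && (t < b)).
    by case: ifP => /=; case: ifP; rewrite ?mulr1 ?mulr0 ?mul0r.
  by apply/idP/idP; rewrite inE/= in_itv.
by apply: cvgM; exact: cvg_flat1.
Qed.

Lemma measurable_bump a b n : measurable_fun setT (smooth_bump a b n).
Proof.
apply: continuous_measurable_fun => t; apply: cvgM.
  apply: (@continuous_comp _ _ _ (fun t => n.+1%:R * (t - a)) (flat 1)).
    by apply: continuousM; [exact: cvg_cst|apply: cvgB;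
      [exact: cvg_id|exact: cvg_cst]].
  exact: continuous_flat.
apply: (@continuous_comp _ _ _ (fun t => n.+1%:R * (b - t)) (flat 1)).
  by apply: continuousM; [exact: cvg_cst|apply: cvgB;
    [exact: cvg_cst|exact: cvg_id]].
exact: continuous_flat.
Qed.

(** Uniqueness tests the induction equation with these products alone; up to constants they are
    closed under spatial derivatives. *)
Definition bump_mode d (L : 'rV[R]_d) a b n k m (p : R * 'rV[R]_d) :=
  smooth_bump a b n p.1 * mode L k m p.2.

Lemma derive_bump_mode d (L : 'rV[R]_d) a b n k m v :
  'D_(0, v) (bump_mode L a b n k m) =
  (fun p => phase L k v * bump_mode L a b n k (m + 1) p).
Proof.
apply/funext => p; have [d1 d2] := derive_mode L k m p.2 v.
have H : is_derive p.2 v (smooth_bump a b n p.1 *: mode L k m)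
    (smooth_bump a b n p.1 *: (phase L k v * mode L k (m + 1) p.2)).
  apply: is_deriveZ; apply: DeriveDef => //; exact: diff_derivable.
have := @is_derive_transport _ _ _ _ (bump_mode L a b n k m) p (0, v) _ _ _ _ H.
move=> K; rewrite (@derive_val _ _ _ _ _ _ _ (K _)).
  by rewrite /bump_mode /GRing.scale/= mulrCA.
by move=> h; rewrite /bump_mode /= scaler0 add0r.
Qed.

Lemma smooth_bump_mode d (L : 'rV[R]_d) a b n k m :
  smooth (bump_mode L a b n k m).
Proof.
have sflat (N c : R) : smooth (fun p : R * 'rV[R]_d => flat 1 (N * p.1 + c)).
  apply: (@smooth_family_affine _ _ _ (fun p => 'X^2 * (p - p^`())) flat
    (fun p : R * 'rV[R]_d => N * p.1 + c) (fun v => N * v.1)).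
  - exact: is_derive_flat.
  - move=> p; apply: differentiableD => //; apply: differentiableM => //.
    by apply: linear_differentiable => q; exact: cvg_fst.
  - move=> v p; apply: derive_val; apply: is_derive_affine => h.
    by rewrite /= /GRing.scale/=; ring.
apply: smoothM; last first.
  apply: (@smooth_family_affine _ _ _ (fun j => j + 1) qcos
    (fun p : R * 'rV[R]_d => phase L k p.2) (fun v => phase L k v.2)).
  - exact: is_derive_qcos.
  - move=> p; apply: (@differentiable_comp _ _ _ _ snd (phase L k)).
      by apply: linear_differentiable => q; exact: cvg_snd.
    exact: differentiable_phase.
  - move=> v p; apply: derive_val; apply: is_derive_affine => h.
    by rewrite /= phaseD addrC.
apply: smoothM.
  have := sflat n.+1%:R (- (n.+1%:R * a)).
  by under eq_fun do rewrite -mulrBr.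
have := sflat (- n.+1%:R) (n.+1%:R * b).
by under eq_fun do rewrite mulNr addrC -mulrBr.
Qed.

Lemma test_time_space_bump_mode d (L : 'rV[R]_d) T a b n k m :
  (forall i, 0 < L 0 i) -> 0 < a -> a < b -> b < T ->
  test_time_space T L (bump_mode L a b n k m).
Proof.
move=> L0 a0 ab bT; split.
- exact: smooth_bump_mode.
- by move=> t x j; rewrite /bump_mode /= periodic_mode.
- exists a, b; split => // t x; rewrite /bump_mode /= mulf_eq0 negb_or.
  by move=> /andP[/bump_support].
Qed.

End test_functions.

Lemma Rintegral_sum d (T : measurableType d) (R : realType)
    (mu : {measure set T -> \bar R}) (D : set T) (I : Type) (s : seq I)
    (f : I -> T -> R) : measurable D ->
  (forall i, mu.-integrable D (EFin \o f i)) ->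
  mu.-integrable D (EFin \o (fun x => \sum_(i <- s) f i x)) /\
  \int[mu]_(x in D) (\sum_(i <- s) f i x) = \sum_(i <- s) \int[mu]_(x in D) f
    i x.
Proof.
move=> mD fi; elim: s => [|i s [IH1 IH2]].
  split.
    rewrite (_ : _ \o _ = cst 0%E); first exact: integrable0.
    by apply/funext => x /=; rewrite big_nil.
  under eq_Rintegral do rewrite big_nil.
  by rewrite big_nil Rintegral_cst// mul0r.
split.
  have := integrableD mD (fi i) IH1; congr (is_true (integrable _ _ _)).
  by apply/funext => x /=; rewrite big_cons.
rewrite big_cons -IH2 -RintegralD//.
by apply: eq_Rintegral => x _; rewrite big_cons.
Qed.

Lemma measurable_rV_coords d (X : measurableType d) (R : realType) n (D : set X)
    (f : X -> 'rV[R]_n) : measurable D ->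
  (forall i, measurable_fun D (fun x => f x 0 i)) -> measurable_fun D f.
Proof.
move=> mD mf.
apply: (@measurability _ _ _ _ _ _
  (\big[setU/set0]_(i < n)
     preimage_set_system setT (fun x : 'rV[R]_n => x 0 i) measurable)) => //.
move=> _ [A + <-]; rewrite -bigcup_seq => -[i _ [B mB <-]].
by rewrite setTI; exact: mf.
Qed.

(** * Fourier modes in space-time *)

Section space_time.
Context {R : realType} {d : nat}.
Variables (L : 'rV[R]_d) (T : R).
Hypothesis L0 : forall i, 0 < L 0 i.

Notation P := (lebesgue_measure \x (lebesgue_rV d))%E.
Let J : set (measurableTypeR R) := `]0, T[%classic.
Let E : set (measurableTypeR R * 'rV[R]_d) := J `*` cell L.

Let mJ : measurable J. Proof. exact: measurable_itv. Qed.
Let mC : measurable (cell L). Proof. exact: measurable_cell. Qed.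
Let mE : measurable E. Proof. exact: measurableX. Qed.

Let slab : set (measurableTypeR R * 'rV[R]_d) := [set p | 0 < p.1 < T].

Let slabE : slab = J `*` setT.
Proof.
apply/seteqP; split=> -[t x] /=; rewrite /slab /J /= in_itv//=.
by case.
Qed.

Lemma measurable_slab : measurable slab.
Proof. by rewrite slabE; exact: measurableX. Qed.

Let E_slab : E `<=` slab.
Proof. by move=> [t x] []; rewrite /J /= in_itv. Qed.

Lemma finite_space_time : (P E < +oo)%E.
Proof.
rewrite product_measure1E// lte_mul_pinfty// ?lebesgue_cell_fin//.
  by rewrite ge0_fin_numE//= lebesgue_measure_itv/=; case: ifP => _;
    rewrite ?ltry// -EFinB ltry.
Qed.

Lemma L2_norm_integrable (u : R -> 'rV[R]_d -> 'rV[R]_d) :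
  measurable_fun slab (fun p => u p.1 p.2) ->
  P.-integrable E (EFin \o (fun p => \sum_i u p.1 p.2 0 i ^+ 2)) <->
  (\int[lebesgue_measure]_(t in `]0%R, T[) L2norm_sq L (u t) < +oo)%E.
Proof.
move=> mu; pose q (p : measurableTypeR R * 'rV[R]_d) :=
  \sum_i u p.1 p.2 0 i ^+ 2.
have mq : measurable_fun E (EFin \o q).
  apply/measurable_EFinP; apply: measurable_sum => i; apply: measurable_funX.
  apply: measurable_funS measurable_slab E_slab _.
  exact: measurableT_comp (measurable_coord_rV i) mu.
have q0 p : (0 <= (EFin \o q) p)%E by rewrite lee_fin sumr_ge0// => i _;
  exact: sqr_ge0.
have -> : (\int[lebesgue_measure]_(t in `]0%R, T[) L2norm_sq L (u t) =
    \int[P]_(p in E) `|(EFin \o q) p|)%E.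
  under [RHS]eq_integral do rewrite gee0_abs//.
  rewrite [LHS]integral_mkcond [RHS]integral_mkcond fubini_tonelli1.
  - apply: eq_integral => t _; rewrite patchE; case: ifPn => tJ.
      rewrite /L2norm_sq integral_mkcond; apply: eq_integral => x _.
      rewrite !patchE (_ : ((t, x) \in E) = (x \in cell L))//.
      apply/idP/idP; rewrite !inE; first by case.
      by move=> Cx; split => //; exact/set_mem.
    rewrite /fubini_F integral0_eq// => x _; rewrite patchE ifF//.
    by apply/negbTE; apply: contra tJ; rewrite !inE => -[].
  - exact: (measurable_restrictT _ mE).1 mq.
  - by move=> p; rewrite patchE; case: ifP.
split; first by move=> /integrableP[].
by move=> h; apply/integrableP.
Qed.

(** From $|z|\le1+z^2$ and the finite measure of the space-time cell. *)
Lemma L2_time_integrable (u : R -> 'rV[R]_d -> 'rV[R]_d) i :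
  L2_Hper T L 0 u -> P.-integrable E (EFin \o (fun p => u p.1 p.2 0 i)).
Proof.
move=> [mu _ /(L2_norm_integrable mu).2 iu].
have i1 : P.-integrable E (EFin \o (cst 1 : _ -> R)).
  apply: measurable_bounded_integrable => //; first exact: finite_space_time.
  exists 1; split; first exact: num_real.
  by move=> M M1 x _ /=; rewrite normr1 ltW.
apply: (le_integrable mE _ _ (integrableD mE i1 iu)).
  apply/measurable_EFinP; apply: measurable_funS measurable_slab E_slab _.
  exact: measurableT_comp (measurable_coord_rV i) mu.
move=> p _ /=; rewrite lee_fin.
set s := \sum_j _; have s0 : 0 <= s by rewrite sumr_ge0// => j _;
  exact: sqr_ge0.
have : `|u p.1 p.2 0 i| ^+ 2 <= s.
  rewrite real_normK ?num_real// /s (bigD1 i)//= lerDl sumr_ge0// => j _.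
  exact: sqr_ge0.
rewrite (@ger0_norm _ (1 + s)) ?addr_ge0//.
have := normr_ge0 (u p.1 p.2 0 i); set z := `|_|; nra.
Qed.

Lemma measurable_bump_mode a b n k m : measurable_fun E (bump_mode L a b n k m).
Proof.
apply: measurable_funTS; apply: measurable_funM.
  exact: measurableT_comp (measurable_bump a b n) measurable_fst.
exact: measurableT_comp (measurable_mode L k m) measurable_snd.
Qed.

Lemma bump_mode_le1 a b n k m p : `|bump_mode L a b n k m p| <= 1.
Proof. by rewrite normrM mulr_ile1// ?bump_le1// mode_le1. Qed.

Lemma integrable_bump_mode f a b n k m :
  P.-integrable E (EFin \o f) ->
  P.-integrable E (EFin \o (fun p => f p * bump_mode L a b n k m p)).
Proof.
move=> fi; apply: integrableM_bounded fi _ _ => //.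
- exact: measurable_bump_mode.
- by move=> p _; exact: bump_mode_le1.
Qed.

Lemma distr_of_bumpE (f : R -> 'rV[R]_d -> R) a b n k m :
  P.-integrable E (EFin \o (fun p => f p.1 p.2)) ->
  distr_of T L f (bump_mode L a b n k m) =
  Rintegral P E (fun p => f p.1 p.2 * bump_mode L a b n k m p).
Proof.
move=> fi; rewrite /distr_of /space_int.
by rewrite -(Rintegral_prod12 mJ mC (integrable_bump_mode a b n k m fi)).
Qed.

Lemma distr_of_bump_sum (I : Type) (s : seq I) (c : I -> R)
    (f : I -> R -> 'rV[R]_d -> R) a b n k m :
  (forall i, P.-integrable E (EFin \o (fun p => f i p.1 p.2))) ->
  distr_of T L (fun t x =>
    \sum_(i <- s) c i * f i t x) (bump_mode L a b n k m) =
  \sum_(i <- s) c i * distr_of T L (f i) (bump_mode L a b n k m).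
Proof.
move=> fi; have cfi i : P.-integrable E (EFin \o (fun p => c i * f i p.1 p.2)).
  exact: (integrableZl mE (c i) (fi i)).
have [i1 _] := Rintegral_sum s mE cfi.
rewrite distr_of_bumpE//.
under eq_Rintegral do rewrite mulr_suml.
have cfbi i := integrable_bump_mode a b n k m (cfi i).
have [_ ->] := Rintegral_sum s mE cfbi.
apply: eq_bigr => i _; rewrite distr_of_bumpE//.
under eq_Rintegral do rewrite -mulrA.
by rewrite RintegralZl//; exact: integrable_bump_mode.
Qed.

Lemma distr_of_bump_fiber (f : R -> 'rV[R]_d -> R) a b n k m :
  P.-integrable E (EFin \o (fun p => f p.1 p.2)) ->
  distr_of T L f (bump_mode L a b n k m) =
  \int[lebesgue_measure]_(t in J)
    (space_int L (fun x => f t x * mode L k m x) * smooth_bump a b n t).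
Proof.
move=> fi.
have ifm : P.-integrable E (EFin \o (fun p => f p.1 p.2 * mode L k m p.2)).
  apply: (integrableM_bounded mE fi (M := 1)); last by move=> p _;
    exact: mode_le1.
  apply: measurable_funTS.
  exact: measurableT_comp (measurable_mode L k m) measurable_snd.
have i1 := integrable_Rintegral_slice mJ mC ifm.
have i2 := integrable_Rintegral_slice mJ mC (integrable_bump_mode a b n k m fi).
apply: ae_eq_Rintegral => //.
- by apply/measurable_EFinP; exact: measurable_int i2.
- apply: measurable_funM; first by apply/measurable_EFinP;
  exact: measurable_int i1.
  by apply: measurable_funTS; exact: measurable_bump.
(* The time factor leaves the space integral only at times whose slice is integrable, that is,
   almost always. *)
apply: ae_imply (ae_integrable_slice mJ mC ifm) => t /[apply] it.
rewrite /space_int -RintegralZr//.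
by apply: eq_Rintegral => x _; rewrite /bump_mode /=; ring.
Qed.

(** As the bumps tend to indicators, every Fourier coefficient has zero integral over each interval
    inside []0, T[], hence vanishes at almost every time. A common null set of times for all modes
    then allows [fourier_cell] at fixed time. *)
Lemma fourier_space_time (f : R -> 'rV[R]_d -> R) :
  P.-integrable E (EFin \o (fun p => f p.1 p.2)) ->
  ae_time T (fun t => measurable_fun setT (f t)) ->
  (forall k m a b n, 0 < a -> a < b -> b < T ->
    distr_of T L f (bump_mode L a b n k m) = 0) ->
  ae_time T (fun t => {ae lebesgue_rV d, forall x, cell L x -> f t x = 0}).
Proof.
move=> fi mf f0.
pose fh k m t := space_int L (fun x => f t x * mode L k m x).
have ifm k m : P.-integrable E (EFin \o (fun p => f p.1 p.2 * mode L k m p.2)).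
  apply: (integrableM_bounded mE fi (M := 1)); last by move=> p _;
    exact: mode_le1.
  apply: measurable_funTS.
  exact: measurableT_comp (measurable_mode L k m) measurable_snd.
have ifh k m : lebesgue_measure.-integrable J (EFin \o fh k m).
  exact: (integrable_Rintegral_slice mJ mC (ifm k m)).
have fh0 k m : {ae lebesgue_measure, forall t : measurableTypeR R,
    0 < t < T -> fh k m t = 0}.
  apply: ae_zero_itv => // a b a0 ab bT.
  pose A : set (measurableTypeR R) := `]a, b[%classic.
  suff : \int[lebesgue_measure]_(t in J) (fh k m t * \1_A t) = 0.
    have sub (x : R) : a < x < b -> 0 < x < T by lra.
    move=> <-; have -> : `]a, b[%classic = J `&` A.
      apply/seteqP; split=> x; last by case.
      by rewrite /= in_itv => abx; split; rewrite /J /A/= in_itv//; exact: sub.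
    rewrite Rintegral_mkcondr; apply: eq_Rintegral => x _.
    by rewrite patchE indicE; case: ifP => _; rewrite ?mulr1 ?mulr0.
  apply: (@Rintegral_cvg0 _ _ R lebesgue_measure J mJ (fh k m) (smooth_bump a
    b) _ 1) => //.
  - by move=> n; apply: measurable_funTS; exact: measurable_bump.
  - by apply: measurable_funTS; apply: measurable_indic; exact: measurable_itv.
  - by move=> n x _; exact: bump_le1.
  - by apply: aeW => x _; exact: cvg_bump.
  - by move=> n; rewrite -(distr_of_bump_fiber a b n k m fi); exact: f0.
have := ae_and (ae_integrable_slice mJ mC fi) (ae_and mf
    (ae_forall_countable (fun p : 'rV[int]_d * int => fh0 p.1 p.2))).
apply: ae_imply => t [it [mt ft]] tT.
have Jt : J t by rewrite /J /= in_itv.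
apply: fourier_cell => //; first exact: mt.
  exact: it.
by move=> k m; exact: (ft (k, m)).
Qed.

End space_time.

(** * Constraints on the Fourier coefficients of a velocity *)

Section uniqueness.
Context {R : realType} {d : nat}.
Variables (L : 'rV[R]_d) (T : R).
Hypothesis L0 : forall i, 0 < L 0 i.

Notation P := (lebesgue_measure \x (lebesgue_rV d))%E.
Let J : set (measurableTypeR R) := `]0, T[%classic.
Let E : set (measurableTypeR R * 'rV[R]_d) := J `*` cell L.

Let mJ : measurable J. Proof. exact: measurable_itv. Qed.
Let mC : measurable (cell L). Proof. exact: measurable_cell. Qed.
Let mE : measurable E. Proof. exact: measurableX. Qed.

Notation fint f := (P.-integrable E (EFin \o (fun p => f p.1 p.2))).

Lemma distr_of_bump_sub (c1 c2 : R) (f1 f2 : R -> 'rV[R]_d -> R) a b n k m :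
  fint f1 -> fint f2 ->
  distr_of T L (fun t x => f1 t x * c1 - f2 t x * c2) (bump_mode L a b n k m) =
  c1 * distr_of T L f1 (bump_mode L a b n k m) -
  c2 * distr_of T L f2 (bump_mode L a b n k m).
Proof.
move=> i1 i2.
pose c (e : bool) := if e then c1 else - c2.
pose f (e : bool) := if e then f1 else f2.
have fi e : fint (f e) by case: e.
have -> : (fun t x => f1 t x * c1 - f2 t x * c2) =
    (fun t x => \sum_(e <- [:: true; false]) c e * f e t x).
  apply/funext => t; apply/funext => x.
  by rewrite big_cons big_seq1 /c /f mulNr mulrC [c2 * _]mulrC.
by rewrite distr_of_bump_sum// big_cons big_seq1 /c /f mulNr.
Qed.

Lemma distr_of_bumpZ (f : R -> 'rV[R]_d -> R) c a b n k m : fint f ->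
  distr_of T L f (fun p => c * bump_mode L a b n k m p) =
  c * distr_of T L f (bump_mode L a b n k m).
Proof.
move=> fi; have := @distr_of_bump_sub c 0 f f a b n k m fi fi.
rewrite mul0r subr0 => <-; rewrite /distr_of.
apply: eq_Rintegral => t _; apply: eq_Rintegral => x _.
by rewrite mulr0 subr0 mulrA.
Qed.

Lemma distr_of_bump_eq0 (f : R -> 'rV[R]_d -> R) a b n k m : fint f ->
  ae_time T (fun t => space_int L (fun x => f t x * mode L k m x) = 0) ->
  distr_of T L f (bump_mode L a b n k m) = 0.
Proof.
move=> fi f0; rewrite distr_of_bump_fiber//.
have ifm : P.-integrable E (EFin \o (fun p => f p.1 p.2 * mode L k m p.2)).
  apply: (integrableM_bounded mE fi (M := 1)); last by move=> p _;
    exact: mode_le1.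
  apply: measurable_funTS.
  exact: measurableT_comp (measurable_mode L k m) measurable_snd.
have i1 := integrable_Rintegral_slice mJ mC ifm.
transitivity (\int[lebesgue_measure]_(t in J) (0 : R)); last first.
  by rewrite Rintegral_cst// mul0r.
apply: ae_eq_Rintegral => //.
  apply: measurable_funM; first by apply/measurable_EFinP;
    exact: measurable_int i1.
  by apply: measurable_funTS; exact: measurable_bump.
apply: ae_imply f0 => t ft; rewrite /J /= in_itv/= => /ft ->.
by rewrite mul0r.
Qed.

Lemma ae_time_integrable (f : R -> 'rV[R]_d -> R) : fint f ->
  ae_time T (fun t => (lebesgue_rV d).-integrable (cell L) (EFin \o f t)).
Proof.
move=> fi; apply: ae_imply (ae_integrable_slice mJ mC fi) => t ft tT.
by apply: ft; rewrite /J /= in_itv.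
Qed.

Lemma div_free_bump (v : R -> 'rV[R]_d -> 'rV[R]_d) a b n k m :
  L2_Hper T L 0 v -> div_free T L v ->
  \sum_j lattice_vec L k 0 j *
    distr_of T L (fun t x => v t x 0 j) (bump_mode L a b n k m) = 0.
Proof.
move=> vL2 dv.
have vi j := L2_time_integrable j vL2.
pose g t x := \sum_j lattice_vec L k 0 j * v t x 0 j.
rewrite -(@distr_of_bump_sum _ _ L T _ (index_enum _) (lattice_vec L k 0)
  (fun j t x => v t x 0 j) a b n k m vi) -/g.
have gi : fint g.
  have gvi j : fint (fun t x => lattice_vec L k 0 j * v t x 0 j).
    exact: (integrableZl mE (lattice_vec L k 0 j) (vi j)).
  by have [] := Rintegral_sum (index_enum _) mE gvi.
apply: (@distr_of_bump_eq0 g) => //.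
apply: ae_imply (ae_and dv (@ae_time_integrable g gi)) => t [dvt git] tT.
(* The gradient of the mode of shift [m - 1] is $2\pi g(k)$ times the mode of shift [m]. *)
have := dvt tT _ (test_space_mode k (m - 1) L0).
have -> : (fun x => \sum_j v t x 0 j * 'D_(e_ j) (mode L k (m - 1)) x) =
    (fun x => 2 * pi * ((\sum_j lattice_vec L k 0 j * v t x 0 j) * mode L k m
      x)).
  apply/funext => x; rewrite mulr_suml mulr_sumr; apply: eq_bigr => j _.
  by rewrite (derive_mode L k (m - 1) x (e_ j)).2 subrK phase_e; ring.
rewrite /space_int RintegralZl//; last first.
  apply: (integrableM_bounded mC (git tT) (M := 1)); last by move=> x _;
    exact: mode_le1.
  by apply: measurable_funTS; exact: measurable_mode.
by move=> /eqP; rewrite mulf_eq0 gt_eqF ?mulr_gt0 ?pi_gt0//= => /eqP.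
Qed.

Lemma zero_mean_bump (v : R -> 'rV[R]_d -> 'rV[R]_d) a b n m j :
  L2_Hper T L 0 v -> zero_mean T L v ->
  distr_of T L (fun t x => v t x 0 j) (bump_mode L a b n 0 m) = 0.
Proof.
move=> vL2 zv; have vi := L2_time_integrable j vL2.
apply: (@distr_of_bump_eq0 (fun t x => v t x 0 j)) => //.
apply: ae_imply (ae_and zv (@ae_time_integrable (fun t x => v t x 0 j) vi)) =>
  t [zt vt] tT.
have -> : (fun x => v t x 0 j * mode L 0 m x) = (fun x => v t x 0 j * qcos m 0).
  apply/funext => x; rewrite /mode /phase big1 ?mulr0// => i _.
  by rewrite !mxE mul0r mul0r.
by rewrite /space_int RintegralZr//; [rewrite [X in X * _]zt// mul0r|exact: vt].
Qed.

Lemma velocity_eq (v w : R -> 'rV[R]_d -> 'rV[R]_d) :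
  L2_Hper T L 0 v -> L2_Hper T L 0 w ->
  (forall i k m a b n, 0 < a -> a < b -> b < T ->
    distr_of T L (fun t x => w t x 0 i) (bump_mode L a b n k m) =
    distr_of T L (fun t x => v t x 0 i) (bump_mode L a b n k m)) ->
  field_eq T L w v.
Proof.
move=> vL2 wL2 vw.
have vi j := L2_time_integrable j vL2.
have wi j := L2_time_integrable j wL2.
(* The factors 1 give the difference the shape of [distr_of_bump_sub]. *)
have H i : ae_time T (fun t => {ae lebesgue_rV d, forall x, cell L x ->
    w t x 0 i * 1 - v t x 0 i * 1 = 0}).
  apply: (fourier_space_time L0 (f := fun t x =>
    w t x 0 i * 1 - v t x 0 i * 1)).
  - have := integrableB mE (wi i) (vi i); congr (is_true (integrable _ _ _)).
    by apply/funext => p /=; rewrite !mulr1.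
  - have [_ vp _] := vL2; have [_ wp _] := wL2.
    apply: ae_imply (ae_and vp wp) => t [vt wt] tT.
    have [_ mv _] := vt tT; have [_ mw _] := wt tT.
    by apply: measurable_funB; apply: measurable_funM => //;
      apply: measurableT_comp (measurable_coord_rV i) _.
  - move=> k m a b n a0 ab bT.
    by rewrite distr_of_bump_sub// !mul1r vw// subrr.
apply: ae_imply (ae_forall_countable H) => t Ht tT.
have := ae_forall_countable (fun i => Ht i tT); apply: ae_imply => x wvx Lx.
apply/rowP => i; apply/eqP; rewrite -subr_eq0; apply/eqP.
by have := wvx i Lx; rewrite !mulr1.
Qed.

End uniqueness.

Section incommensurable.
Context {R : realType}.
Variables (T eta : R).
Hypothesis T0 : 0 < T.

(** Summing cyclically from [i] matches the indexing of [cross3] and [curl3], so one computation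
    covers all three components. *)
Lemma sum_ord3 (f : 'I_3 -> R) i : \sum_j f j = f i + f (i + 1) + f (i + 2%:R).
Proof.
have E (j l : 'I_3) : val j = val l -> f j = f l by move=> /val_inj ->.
rewrite !big_ord_recl big_ord0.
case: i => [[|[|[|//]]] i3].
- by rewrite addr0 addrA; congr (_ + _ + _); exact: E.
- have -> : f (Ordinal i3) = f (lift ord0 ord0) by exact: E.
  have -> : f (Ordinal i3 + 1) = f (lift ord0 (lift ord0 ord0)) by exact: E.
  have -> : f (Ordinal i3 + 2%:R) = f ord0 by exact: E.
  by rewrite addr0; ring.
- have -> : f (Ordinal i3) = f (lift ord0 (lift ord0 ord0)) by exact: E.
  have -> : f (Ordinal i3 + 1) = f ord0 by exact: E.
  have -> : f (Ordinal i3 + 2%:R) = f (lift ord0 ord0) by exact: E.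
  by rewrite addr0; ring.
Qed.

End incommensurable.

(** * Uniqueness *)

Section curl.
Context {R : realType}.
Variable T : R.

Notation coord_integrable L v := (forall j,
  (lebesgue_measure \x lebesgue_rV _)%E.-integrable
    ((`]0%R, T[%classic : set (measurableTypeR R)) `*` cell L)
    (EFin \o (fun p => v p.1 p.2 0 j))).

(* The values [A j] are abstract to keep [distr_of] out of the algebra. *)
Lemma distr_dx_bump_sub d (L : 'rV[R]_d) (v : R -> 'rV[R]_d -> 'rV[R]_d)
    (c1 c2 : R) (j1 j2 j : 'I_d) a b n k m (A : 'I_d -> R) :
  coord_integrable L v ->
  (forall j, distr_of T L (fun t x =>
    v t x 0 j) (bump_mode L a b n k (m + 1)) = A j) ->
  distr_dx j (distr_of T L (fun t x => v t x 0 j1 * c1 - v t x 0 j2 * c2))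
    (bump_mode L a b n k m) =
  - (phase L k (e_ j) * (c1 * A j1 - c2 * A j2)).
Proof.
move=> vi vA; rewrite /distr_dx derive_bump_mode -!vA; congr (- _).
pose f t x := v t x 0 j1 * c1 - v t x 0 j2 * c2.
have mE : measurable ((`]0%R, T[%classic : set (measurableTypeR R)) `*` cell L).
  by apply: measurableX; [exact: measurable_itv|exact: measurable_cell].
have fi : (lebesgue_measure \x lebesgue_rV d)%E.-integrable
    ((`]0%R, T[%classic : set (measurableTypeR R)) `*` cell L)
    (EFin \o (fun p => f p.1 p.2)).
  have := integrableB mE (integrableZl mE c1 (vi j1)) (integrableZl mE c2 (vi
    j2)).
  congr (is_true (integrable _ _ _)); apply/funext => p /=.
  by rewrite /f [_ * c1]mulrC [_ * c2]mulrC.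
rewrite (distr_of_bumpZ (f := f))//; congr (_ * _).
exact: (@distr_of_bump_sub _ _ L T c1 c2 (fun t x => v t x 0 j1)
  (fun t x => v t x 0 j2) a b n k (m + 1) (vi j1) (vi j2)).
Qed.

Lemma curl_cross2_bump (L F : 'rV[R]_2) (v : R -> 'rV[R]_2 -> 'rV[R]_2)
    a b n k m (A : 'I_2 -> R) : coord_integrable L v ->
  (forall j, distr_of T L (fun t x =>
    v t x 0 j) (bump_mode L a b n k (m + 1)) = A j) ->
  forall i, curl_cross T L v F i (bump_mode L a b n k m) =
    if i == 0 then - (phase L k (e_ 1) * (F 0 1 * A 0 - F 0 0 * A 1))
    else phase L k (e_ 0) * (F 0 1 * A 0 - F 0 0 * A 1).
Proof.
move=> vi vA i; rewrite /= /curl2 /cross2.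
by case: ifP => _; rewrite (distr_dx_bump_sub _ _ _ _ _ vi vA) ?opprK.
Qed.

Lemma curl_cross3_bump (L F : 'rV[R]_3) (v : R -> 'rV[R]_3 -> 'rV[R]_3)
    a b n k m (A : 'I_3 -> R) : coord_integrable L v ->
  (forall j, distr_of T L (fun t x =>
    v t x 0 j) (bump_mode L a b n k (m + 1)) = A j) ->
  forall i, curl_cross T L v F i (bump_mode L a b n k m) =
  phase L k (e_ (i + 2%:R)) * (F 0 i * A (i + 2%:R) - F 0 (i + 2%:R) * A i)
  - phase L k (e_ (i + 1)) * (F 0 (i + 1) * A i - F 0 i * A (i + 1)).
Proof.
move=> vi vA i; rewrite /= /curl3.
have S l : (fun t x => cross3 (v t x) F 0 l) =
    (fun t x => v t x 0 (l + 1) * F 0 (l + 2%:R) - v t x 0 (l + 2%:R) * F 0 (l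
      + 1)).
  by apply/funext => t; apply/funext => x; rewrite mxE.
rewrite !S !(distr_dx_bump_sub _ _ _ _ _ vi vA).
have -> : i + 2%:R + 1 = i :> 'I_3 by apply/val_inj; case: i => [[|[|[|]]]].
have -> : i + 2%:R + 2%:R = i + 1 :> 'I_3 by apply/val_inj;
  case: i => [[|[|[|]]]].
have -> : i + 1 + 1 = i + 2%:R :> 'I_3 by apply/val_inj; case: i => [[|[|[|]]]].
have -> : i + 1 + 2%:R = i :> 'I_3 by apply/val_inj; case: i => [[|[|[|]]]].
by rewrite opprK addrC.
Qed.

Variable eta : R.

(* The Fourier form of [F . grad u = F div u]. *)
Lemma curl_bump_eq d (hd : d = 2%N \/ d = 3%N) (L F : 'rV[R]_d)
    (b v w : R -> 'rV[R]_d -> 'rV[R]_d) a0 b0 n k m (A B : 'I_d -> R) :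
  (forall i, 0 < L 0 i) -> 0 < a0 -> a0 < b0 -> b0 < T ->
  velocity_solution T eta L F b v -> velocity_solution T eta L F b w ->
  (forall j, distr_of T L (fun t x =>
    v t x 0 j) (bump_mode L a0 b0 n k m) = A j) ->
  (forall j, distr_of T L (fun t x =>
    w t x 0 j) (bump_mode L a0 b0 n k m) = B j) ->
  forall i, (\sum_j F 0 j * lattice_vec L k 0 j) * (B i - A i) =
  F 0 i * \sum_j lattice_vec L k 0 j * (B j - A j).
Proof.
move=> L0 a00 ab bT [[vL2 _] _ vE _] [[wL2 _] _ wE _] vA wB i.
have vi j := L2_time_integrable j vL2; have wi j := L2_time_integrable j wL2.
(* The terms in [b] agree in the two equations and cancel. The derivative in the curl raises the
   shift [m - 1] to [m]. *)
have C l : curl_cross T L w F l (bump_mode L a0 b0 n k (m - 1)) =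
    curl_cross T L v F l (bump_mode L a0 b0 n k (m - 1)).
  have t := test_time_space_bump_mode n k (m - 1) L0 a00 ab bT.
  by have := wE l _ t; rewrite vE// => /addrI.
have p0 : 2 * pi != 0 :> R by rewrite mulf_neq0// gt_eqF// pi_gt0.
have {}vA j : distr_of T L (fun t x =>
  v t x 0 j) (bump_mode L a0 b0 n k (m - 1 + 1)) = A j.
  by rewrite subrK.
have {}wB j : distr_of T L (fun t x =>
  w t x 0 j) (bump_mode L a0 b0 n k (m - 1 + 1)) = B j.
  by rewrite subrK.
clear vE wE; case: hd => hd; subst d.
  have C0 := C 0; have C1 := C 1; clear C.
  rewrite (curl_cross2_bump F vi vA) (curl_cross2_bump F wi wB) !phase_e /= in
    C0.
  rewrite (curl_cross2_bump F vi vA) (curl_cross2_bump F wi wB) !phase_e /= in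
    C1.
  move/oppr_inj : C0; rewrite -!(mulrA (2 * pi)) => /(mulfI p0) C0.
  move: C1; rewrite -!(mulrA (2 * pi)) => /(mulfI p0) C1.
  clear vi wi vA wB.
  move: (lattice_vec L k 0) C0 C1 => g C0 C1; move: (F 0) C0 C1 => G C0 C1.
  rewrite !big_ord_recl !big_ord0 !addr0.
  have E0 : lift ord0 ord0 = 1 :> 'I_2 by exact/val_inj.
  rewrite E0 -[ord0]/(0 : 'I_2).
  have [->|->] : i = 0 \/ i = 1.
    by case: i => [[|[|//]]] i2; [left|right]; exact/val_inj.
  - move: (g 0) (g 1) (G 0) (G 1) (A 0) (A 1) (B 0) (B 1) C0 C1 => *; lra.
  - move: (g 0) (g 1) (G 0) (G 1) (A 0) (A 1) (B 0) (B 1) C0 C1 => *; lra.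
move: (C i); rewrite (curl_cross3_bump F vi vA) (curl_cross3_bump F wi wB)
  !phase_e.
rewrite -!(mulrA (2 * pi)) -!mulrBr => /(mulfI p0) Ci.
rewrite !(sum_ord3 _ i); clear C vi wi vA wB.
move: (lattice_vec L k 0) Ci => g; move: (F 0) => G.
move: (g i) (g (i + 1)) (g (i + 2%:R)) (G i) (G (i + 1)) (G (i + 2%:R)).
move: (A i) (A (i + 1)) (A (i + 2%:R)) (B i) (B (i + 1)) (B (i + 2%:R)).
move=> *; lra.
Qed.

Theorem incommensurable_unique d (hd : d = 2%N \/ d = 3%N) (L F : 'rV[R]_d)
    (b v w : R -> 'rV[R]_d -> 'rV[R]_d) : (forall i, 0 < L 0 i) ->
  incommensurable L F ->
  velocity_solution T eta L F b v -> velocity_solution T eta L F b w ->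
  field_eq T L w v.
Proof.
move=> L0 FL vs ws; have [[vL2 vz] vd _ _] := vs; have [[wL2 wz] wd _ _] := ws.
apply: (velocity_eq L0 vL2 wL2) => i k m a0 b0 n a00 ab bT.
have [->|k0] := eqVneq k 0; first by rewrite !zero_mean_bump.
pose A j := distr_of T L (fun t x => v t x 0 j) (bump_mode L a0 b0 n k m).
pose B j := distr_of T L (fun t x => w t x 0 j) (bump_mode L a0 b0 n k m).
have H := @curl_bump_eq d hd L F b v w a0 b0 n k m A B L0 a00 ab bT vs ws
  (fun=> erefl) (fun=> erefl) i.
have SA : \sum_j lattice_vec L k 0 j * A j = 0 by exact: div_free_bump.
have SB : \sum_j lattice_vec L k 0 j * B j = 0 by exact: div_free_bump.
rewrite -[LHS]/(B i) -[RHS]/(A i); clearbody A B.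
apply/eqP; rewrite -subr_eq0; move: H;
  under [X in _ = _ * X]eq_bigr do rewrite mulrBr.
rewrite sumrB SA SB subrr mulr0 => /eqP; rewrite mulf_eq0.
by rewrite (negbTE (FL k k0)).
Qed.

End curl.

(** * Shear flows *)

Section shear_flow.
Context {R : realType}.

Lemma lebesgue_cell_gt0 n (L : 'rV[R]_n) : (forall i, 0 < L 0 i) ->
  (0 < lebesgue_rV n (cell L))%E.
Proof.
elim: n L => [|n IH] L L0 /=.
  by rewrite diracE mem_set ?lte_fin//=; case.
rewrite /lebesgue_rV_succ/= /pushforward cell_cons.
rewrite product_measure1E//; last exact: measurable_cell.
apply: mule_gt0; last by apply: IH => i; rewrite mxE.
by rewrite /= lebesgue_measure_itv/= lte_fin L0 -EFinB lte_fin subr0 L0.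
Qed.

Lemma lattice_vec_neq0 n (L : 'rV[R]_n) k : (forall i, 0 < L 0 i) ->
  k != 0 -> exists j, lattice_vec L k 0 j != 0.
Proof.
move=> L0 /eqP k0; apply: contrapT => H; apply: k0; apply/rowP => j;
  rewrite mxE.
have /eqP : lattice_vec L k 0 j = 0.
  by apply: contrapT => /eqP kj; apply: H; exists j.
by rewrite mxE mulf_eq0 invr_eq0 (gt_eqF (L0 j)) orbF intr_eq0 => /eqP.
Qed.

(** Some component of $g(k)$ is nonzero, and in that direction the mode is a multiple of the partial
    derivative of the periodic mode of shift [m - 1]. *)
Lemma space_int_mode n (L : 'rV[R]_n) k m : (forall i, 0 < L 0 i) ->
  k != 0 -> space_int L (mode L k m) = 0.
Proof.
move=> L0 k0; have [j kj] := lattice_vec_neq0 L0 k0.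
have c0 : phase L k (e_ j) != 0.
  by rewrite phase_e !mulf_neq0// gt_eqF// pi_gt0.
have := @space_int_partial R n L (mode L k (m - 1))
  (fun x => phase L k (e_ j) * mode L k m x) j L0.
rewrite {1}/space_int RintegralZl//; last 2 first.
- exact: measurable_cell.
- exact: continuous_integrable_cell (@continuous_mode _ _ _ _ _).
move=> H; apply: (mulfI c0); rewrite mulr0; apply: H.
- exact: periodic_mode.
- by move=> x; exact: cvgMl_tmp (@continuous_mode _ _ L k m x).
- move=> x; have [d1 d2] := derive_mode L k (m - 1) x (e_ j).
  by rewrite subrK in d2; apply: DeriveDef => //; exact: diff_derivable.
Qed.

(** The squared mode is half of 1 plus the mode of frequency $2k\ne0$, which integrates to zero;
    half the volume of the cell remains. This shows later that the shear flow is not null. *)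
Lemma space_int_mode_sqr n (L : 'rV[R]_n) k : (forall i, 0 < L 0 i) ->
  k != 0 -> 0 < space_int L (fun x => mode L k 0 x * mode L k 0 x).
Proof.
move=> L0 k0.
have kk0 : k + k != 0.
  apply: contra k0 => /eqP kk; apply/eqP/rowP => i; rewrite mxE.
  by have := congr1 (fun z : 'rV[int]_n => z 0 i) kk; rewrite !mxE; lia.
have E x : mode L k 0 x * mode L k 0 x = 2^-1 * (mode L (k + k) 0 x + 1).
  rewrite /mode qcosM subrr; congr (_ * (qcos _ _ + _)).
    rewrite /phase -mulrDr -big_split; congr (_ * _); apply: eq_bigr => i _ /=.
    by rewrite !mxE intrD; ring.
  by rewrite subrr /qcos mul0r addr0 cos0.
have mC := measurable_cell L.
have i1 : (lebesgue_rV n).-integrable (cell L) (EFin \o mode L (k + k) 0).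
  exact: continuous_integrable_cell (@continuous_mode _ _ _ _ _).
have i2 : (lebesgue_rV n).-integrable (cell L) (EFin \o (fun=> 1 : R)).
  by apply: continuous_integrable_cell; exact: cst_continuous.
rewrite /space_int; under eq_Rintegral do rewrite E.
rewrite RintegralZl//; last exact: (integrableD mC i1 i2).
rewrite RintegralD// -[X in X + _]/(space_int L (mode L (k + k) 0)).
rewrite space_int_mode// add0r Rintegral_cst// mul1r mulr_gt0// fine_gt0//.
by rewrite lebesgue_cell_gt0//= lebesgue_cell_fin.
Qed.

Lemma smooth_continuous n (f : 'rV[R]_n -> R) : smooth f ->
  continuous f /\ forall v, continuous ('D_v f).
Proof.
move=> sf; split=> [x|v x]; apply: differentiable_continuous.
  exact: (sf [::]).
exact: (sf [:: v]).
Qed.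

(** Integration by parts: [G j] is the partial derivative of [mode * phi] and integrates to zero. In
    the sum weighted by [c], the part that differentiates the mode carries the factor $c\cdot
    g(k)=0$. *)
Lemma div_free_shear n (L : 'rV[R]_n) k m (c : 'rV[R]_n) phi :
  (forall i, 0 < L 0 i) -> \sum_j c 0 j * lattice_vec L k 0 j = 0 ->
  test_space L phi ->
  space_int L (fun x => \sum_j (mode L k m x * c 0 j) * 'D_(e_ j) phi x) = 0.
Proof.
move=> L0 cg [sphi pphi]; have [cphi cdphi] := smooth_continuous sphi.
pose G j x := mode L k m x * 'D_(e_ j) phi x +
  phi x * (phase L k (e_ j) * mode L k (m + 1) x).
have cG j : continuous (G j).
  move=> x; have cm i := @continuous_mode R n L k i x.
  have c1 : mode L k m y * 'D_(e_ j) phi y @[y --> x] -->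
      mode L k m x * 'D_(e_ j) phi x by exact: cvgM (cm m) (cdphi _ x).
  have c2 : phi y * (phase L k (e_ j) * mode L k (m + 1) y) @[y --> x] -->
      phi x * (phase L k (e_ j) * mode L k (m + 1) x).
    exact: cvgM (cphi x) (cvgMl_tmp (cm (m + 1))).
  exact: cvgD c1 c2.
have iG j : (lebesgue_rV n).-integrable (cell L) (EFin \o G j).
  exact: continuous_integrable_cell.
have G0 j : space_int L (G j) = 0.
  apply: (@space_int_partial R n L (fun x => mode L k m x * phi x) (G j) j) =>
    //.
    by move=> x l; rewrite periodic_mode// pphi.
  move=> x; have [d1 d2] := derive_mode L k m x (e_ j).
  have d3 : derivable phi x (e_ j) by apply: diff_derivable; exact: (sphi [::]).
  have dm : derivable (mode L k m) x (e_ j).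
    exact: diff_derivable.
  apply: DeriveDef; first exact: derivableM dm d3.
  by rewrite (deriveM dm d3) d2.
have mC := measurable_cell L.
have icG j : (lebesgue_rV n).-integrable (cell L) (EFin \o (fun x =>
  c 0 j * G j x)).
  exact: (integrableZl mC (c 0 j) (iG j)).
have [_ S] := Rintegral_sum (index_enum _) mC icG.
rewrite /space_int (_ : (fun x => _) = fun x => \sum_j c 0 j * G j x).
  rewrite S big1// => j _; rewrite RintegralZl//.
  by rewrite -[X in _ * X]/(space_int L (G j)) G0 mulr0.
apply/funext => x; under [RHS]eq_bigr do rewrite /G mulrDr.
rewrite big_split/= [X in _ + X](_ : _ = 0) ?addr0.
  by apply: eq_bigr => j _; ring.
transitivity (phi x * mode L k (m + 1) x * (2 * pi) *
    \sum_j c 0 j * lattice_vec L k 0 j); last by rewrite cg mulr0.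
by rewrite mulr_sumr; apply: eq_bigr => j _; rewrite phase_e; ring.
Qed.


Lemma L2norm_sq_integrable n (L : 'rV[R]_n) (u : 'rV[R]_n -> 'rV[R]_n) :
  measurable_fun setT u ->
  (lebesgue_rV n).-integrable (cell L) (EFin \o (fun x =>
    \sum_i u x 0 i ^+ 2)) <->
  (L2norm_sq L u < +oo)%E.
Proof.
move=> mu.
have mq : measurable_fun (cell L) (EFin \o (fun x => \sum_i u x 0 i ^+ 2)).
  apply/measurable_EFinP/measurable_funTS; apply: measurable_sum => i.
  by apply: measurable_funX; exact: measurableT_comp (measurable_coord_rV i) mu.
have -> : L2norm_sq L u = (\int[lebesgue_rV n]_(x in cell L)
    `|(EFin \o (fun x => (\sum_i u x 0 i ^+ 2)%R)) x|)%E.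
  apply: eq_integral => x _ /=; rewrite ger0_norm// sumr_ge0// => i _.
  exact: sqr_ge0.
by split=> [/integrableP[]|h]//; apply/integrableP.
Qed.

Lemma sum_sqrD_le n (x y : 'rV[R]_n) :
  \sum_i (x + y) 0 i ^+ 2 <= 2 * (\sum_i x 0 i ^+ 2 + \sum_i y 0 i ^+ 2).
Proof.
rewrite -big_split mulr_sumr; apply: ler_sum => i _ /=; rewrite mxE.
by have := sqr_ge0 (x 0 i - y 0 i); rewrite !expr2; nra.
Qed.

Lemma L2norm_sqD n (L : 'rV[R]_n) (u v : 'rV[R]_n -> 'rV[R]_n) :
  measurable_fun setT u -> measurable_fun setT v ->
  (L2norm_sq L u < +oo)%E -> (L2norm_sq L v < +oo)%E ->
  (L2norm_sq L (fun x => u x + v x)%R < +oo)%E.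
Proof.
move=> mu mv /(L2norm_sq_integrable L mu).2 iu /(L2norm_sq_integrable L mv).2
  iv.
have muv : measurable_fun setT (fun x => u x + v x).
  apply/measurable_fun_rVP => i; under eq_fun do rewrite mxE.
  apply: measurable_funD; exact: measurableT_comp (measurable_coord_rV i) _.
apply/(L2norm_sq_integrable L muv).
have mC := measurable_cell L.
apply: (le_integrable mC _ _ (integrableZl mC 2 (integrableD mC iu iv))).
  apply/measurable_EFinP/measurable_funTS; apply: measurable_sum => i.
  by apply: measurable_funX;
    exact: measurableT_comp (measurable_coord_rV i) muv.
move=> x _ /=; rewrite lee_fin.
have s0 (f : 'rV[R]_n) : 0 <= \sum_i f 0 i ^+ 2.
  by apply: sumr_ge0 => i _; exact: sqr_ge0.
rewrite !ger0_norm ?mulr_ge0 ?addr_ge0//; exact: sum_sqrD_le.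
Qed.

Lemma L2_HperD d T (L : 'rV[R]_d) (u v : R -> 'rV[R]_d -> 'rV[R]_d) :
  L2_Hper T L 0 u -> L2_Hper T L 0 v ->
  L2_Hper T L 0 (fun t x => u t x + v t x).
Proof.
move=> [mu pu iu] [mv pv iv].
have mS := @measurable_slab R d T.
have muv : measurable_fun [set p :
  (measurableTypeR R * 'rV[R]_d)%type | 0 < p.1 < T]
    (fun p => u p.1 p.2 + v p.1 p.2).
  apply: measurable_rV_coords => //= i.
  rewrite (_ : (fun _ => _) = (fun p => u p.1 p.2 0 i + v p.1 p.2 0 i));
    last first.
    by apply/funext => p; rewrite mxE.
  by apply: measurable_funD; exact: measurableT_comp (measurable_coord_rV i) _.
split; first exact: muv.
- apply: ae_imply (ae_and pu pv) => t [ut vt] tT.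
  have [up um uL] := ut tT; have [vp vm vL] := vt tT; split.
  + by move=> x j; rewrite up vp.
  + apply/measurable_fun_rVP => i; under eq_fun do rewrite mxE.
    by apply: measurable_funD;
      exact: measurableT_comp (measurable_coord_rV i) _.
  + exact: L2norm_sqD.
- apply/(L2_norm_integrable L muv).
  have mE : measurable ((`]0%R, T[%classic :
    set (measurableTypeR R)) `*` cell L).
    by apply: measurableX; [exact: measurable_itv|exact: measurable_cell].
  apply: (le_integrable mE _ _ (integrableZl mE 2 (integrableD mE
    ((L2_norm_integrable L mu).2 iu) ((L2_norm_integrable L mv).2 iv)))).
    apply/measurable_EFinP; apply: measurable_sum => i; apply: measurable_funX.
    apply: measurable_funS mS _ _; last first.
      exact: measurableT_comp (measurable_coord_rV i) muv.
    by move=> [t x] []; rewrite /= in_itv.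
  move=> p _ /=; rewrite lee_fin.
  have s0 (f : 'rV[R]_d) : 0 <= \sum_i f 0 i ^+ 2.
    by apply: sumr_ge0 => i _; exact: sqr_ge0.
  rewrite !ger0_norm ?mulr_ge0 ?addr_ge0//; exact: sum_sqrD_le.
Qed.

End shear_flow.

(** * Adding a shear flow to a solution *)

Section nonuniqueness.
Context {R : realType}.

Lemma ae_time_ex (T : R) (Q : R -> Prop) : 0 < T -> ae_time T Q ->
  exists2 t, 0 < t < T & Q t.
Proof.
move=> T0 aeQ; apply: contrapT => nQ.
have N : lebesgue_measure.-negligible (`]0, T[%classic :
  set (measurableTypeR R)).
  apply: negligibleS aeQ => t; rewrite /= in_itv/= => tT QT.
  by apply: nQ; exists t => //; exact: QT.
have : lebesgue_measure (`]0, T[%classic : set (measurableTypeR R)) = 0%E.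
  by apply: measure_negligible N; exact: measurable_itv.
rewrite lebesgue_measure_itv/= lte_fin T0 -EFinB subr0 => -[] /eqP.
by rewrite gt_eqF.
Qed.

Lemma shear_direction d (hd : (1 < d)%N) (L F : 'rV[R]_d) (k : 'rV[int]_d) :
  (forall i, 0 < L 0 i) -> k != 0 ->
  \sum_i F 0 i * lattice_vec L k 0 i = 0 ->
  exists a : 'rV[R]_d, [/\ a != 0, \sum_j a 0 j * lattice_vec L k 0 j = 0 &
    a = F \/ F = 0].
Proof.
move=> L0 k0 Fk; have [F0|F0] := eqVneq F 0; last by exists F; split => //;
  left.
have [j gj] := lattice_vec_neq0 L0 k0.
move: (lattice_vec L k) gj {Fk} => g gj.
have [l lj] : exists l : 'I_d, l != j.
  pose i0 := Ordinal (ltnW hd); pose i1 := Ordinal hd.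
  have [ij|ij] := eqVneq i0 j; last by exists i0.
  by exists i1; rewrite -ij -val_eqE.
(* A quarter turn of the projection of [g] to the plane of coordinates [j] and [l]: orthogonal to
   [g], and nonzero because [g 0 j] is. This is where a second dimension enters. *)
exists (g 0 l *: e_ j - g 0 j *: e_ l); split; last by right.
- apply/eqP => /rowP /(_ l); rewrite !mxE !eqxx (negbTE lj) mulr0 mulr1 sub0r.
  by apply/eqP; rewrite oppr_eq0.
- rewrite (bigD1 j)//= (bigD1 l)//= big1 ?addr0; last first.
    move=> i /andP[ij il]; rewrite !mxE (negbTE ij) (negbTE il).
    by rewrite !mulr0 subr0 mul0r.
  rewrite !mxE !eqxx (negbTE lj) [j == l]eq_sym (negbTE lj).
  by rewrite !mulr0 !mulr1 subr0 sub0r mulNr mulrC subrr.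
Qed.

Lemma cross2_shear (x a F : 'rV[R]_2) c : a = F \/ F = 0 ->
  cross2 (x + c *: a) F = cross2 x F.
Proof. by case=> ->; rewrite /cross2 !mxE; ring. Qed.

Lemma cross3_shear (x a F : 'rV[R]_3) c : a = F \/ F = 0 ->
  cross3 (x + c *: a) F = cross3 x F.
Proof. by case=> ->; apply/rowP => i; rewrite !mxE; ring. Qed.

(** The perturbation already drops out of the pointwise cross product, so the distributions coincide
    on all arguments, with no linearity or integrability to check. *)
Lemma curl_cross_shear d (hd : d = 2%N \/ d = 3%N) (T : R) (L F a : 'rV[R]_d)
    (v : R -> 'rV[R]_d -> 'rV[R]_d) (f : 'rV[R]_d -> R) : a = F \/ F = 0 ->
  curl_cross T L (fun t x => v t x + f x *: a) F = curl_cross T L v F.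
Proof.
case: hd => hd; subst d => aF.
  pose S (c : R -> 'rV[R]_2 -> R) := curl2 (distr_of T L c).
  apply: (congr1 S); apply/funext => t; apply/funext => x.
  exact: cross2_shear.
pose S (c : R -> 'rV[R]_3 -> 'rV[R]_3) :=
  curl3 (fun i => distr_of T L (fun t x => c t x 0 i)).
apply: (congr1 S (x := fun t x => cross3 (v t x + f x *: a) F)
  (y := fun t x => cross3 (v t x) F)).
by apply/funext => t; apply/funext => x; exact: cross3_shear.
Qed.

Lemma velocity_solution_shear d (hd : d = 2%N \/ d = 3%N) (T eta : R)
    (L F a : 'rV[R]_d) (k : 'rV[int]_d) (b v : R -> 'rV[R]_d -> 'rV[R]_d) :
  (forall i, 0 < L 0 i) -> k != 0 ->
  \sum_j a 0 j * lattice_vec L k 0 j = 0 -> a = F \/ F = 0 ->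
  velocity_solution T eta L F b v ->
  velocity_solution T eta L F b (fun t x => v t x + mode L k 0 x *: a).
Proof.
move=> L0 k0 ag aF [[vL2 vz] vd vE bd].
have mC := measurable_cell L.
have cu j : continuous (fun x => mode L k 0 x * a 0 j).
  by move=> x; exact: cvgMr_tmp (@continuous_mode _ _ L k 0 x).
have mu : measurable_fun setT (fun x : 'rV[R]_d => mode L k 0 x *: a).
  apply/measurable_fun_rVP => j.
  rewrite (_ : (fun _ => _) = (fun x => mode L k 0 x * a 0 j)).
    exact: continuous_measurable_rV (cu j).
  by apply/funext => x; rewrite mxE.
have uL2 : (L2norm_sq L (fun x => mode L k 0 x *: a)%R < +oo)%E.
  apply/(L2norm_sq_integrable L mu); apply: continuous_integrable_cell.
  apply: continuous_big => [|j _]; first exact: add_continuous.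
  rewrite (_ : (fun _ => _) = (fun x =>
    (mode L k 0 x * a 0 j) * (mode L k 0 x * a 0 j))).
    by move=> x; exact: cvgM (cu j x) (cu j x).
  by apply/funext => x; rewrite mxE expr2.
have utL2 : L2_Hper T L 0 (fun (t : R) x => mode L k 0 x *: a).
  split.
  - apply: measurable_funTS; exact: measurableT_comp mu measurable_snd.
  - apply: aeW => t _; split => //.
    by move=> x j; rewrite periodic_mode.
  - rewrite integral_cst; last exact: measurable_itv.
    have c0 : (0 <= L2norm_sq L (fun x => mode L k 0 x *: a)%R)%E.
      by apply: integral_ge0 => x _; rewrite lee_fin sumr_ge0// => i _;
        exact: sqr_ge0.
    rewrite lte_mul_pinfty//; first by rewrite ge0_fin_numE.
    by rewrite /= lebesgue_measure_itv/=; case: ifP => _;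
      rewrite ?ltry// -EFinB ltry.
have vi j := @ae_time_integrable _ _ L T (fun t x => v t x 0 j)
  (L2_time_integrable j vL2).
have {}vi : ae_time T (fun t => forall j,
    (lebesgue_rV d).-integrable (cell L) (EFin \o (fun x => v t x 0 j))).
  by apply: ae_imply (ae_forall_countable vi) => t vt tT j; exact: vt.
split; last exact: bd.
- split; first exact: L2_HperD.
  apply: ae_imply (ae_and vz vi) => t [vzt vit] tT i.
  have iu := continuous_integrable_cell L (cu i).
  rewrite /space_int (_ : (fun x => _) = fun x =>
    v t x 0 i + mode L k 0 x * a 0 i); last first.
    by apply/funext => x; rewrite !mxE.
  rewrite RintegralD//; last exact: vit.
  rewrite [X in X + _](vzt tT i) add0r RintegralZr//; last first.
    exact: continuous_integrable_cell (@continuous_mode _ _ L k 0).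
  by rewrite [X in X * _](space_int_mode 0 L0 k0) mul0r.
- apply: ae_imply (ae_and vd vi) => t [vdt vit] tT phi tphi.
  have [cphi cdphi] := smooth_continuous tphi.1.
  have ivd j : (lebesgue_rV d).-integrable (cell L)
      (EFin \o (fun x => v t x 0 j * 'D_(e_ j) phi x)).
    have [M phiM] := continuous_bounded_cell L (cdphi (e_ j)).
    apply: (integrableM_bounded mC (vit tT j) _ phiM).
    by apply: measurable_funTS; exact: continuous_measurable_rV.
  have iud j : (lebesgue_rV d).-integrable (cell L)
      (EFin \o (fun x => (mode L k 0 x * a 0 j) * 'D_(e_ j) phi x)).
    apply: continuous_integrable_cell => x.
    exact: cvgM (cu j x) (cdphi (e_ j) x).
  have [isv _] := Rintegral_sum (index_enum _) mC ivd.
  have [isu _] := Rintegral_sum (index_enum _) mC iud.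
  rewrite /space_int (_ : (fun x => _) = fun x =>
    \sum_j v t x 0 j * 'D_(e_ j) phi x +
    \sum_j (mode L k 0 x * a 0 j) * 'D_(e_ j) phi x); last first.
    apply/funext => x; rewrite -big_split; apply: eq_bigr => j _ /=.
    by rewrite !mxE mulrDl.
  rewrite RintegralD// [X in X + _](vdt tT phi tphi) add0r.
  exact: div_free_shear.
- by move=> i phi tphi; rewrite curl_cross_shear//; exact: vE.
Qed.

Theorem unique_incommensurable d (hd : d = 2%N \/ d = 3%N) (T eta : R)
    (L F : 'rV[R]_d) (b v : R -> 'rV[R]_d -> 'rV[R]_d) :
  (forall i, 0 < L 0 i) -> 0 < T -> velocity_solution T eta L F b v ->
  (forall w, velocity_solution T eta L F b w -> field_eq T L w v) ->
  incommensurable L F.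
Proof.
move=> L0 T0 vs uniq k k0; apply/eqP => Fk.
have d1 : (1 < d)%N by case: hd => ->.
have [a [a0 ag aF]] := shear_direction d1 L0 k0 Fk.
have /uniq/(ae_time_ex T0)[t _ tu] := velocity_solution_shear hd L0 k0 ag aF vs.
have [j aj] : exists j, a 0 j != 0.
  apply: contrapT => na; move/eqP : a0; apply; apply/rowP => j; rewrite mxE.
  by apply: contrapT => /eqP aj; apply: na; exists j.
(* Equality at the single time [t] forces the mode to vanish almost everywhere, since [a] has a
   nonzero component; this contradicts the positive integral of its square. *)
have := space_int_mode_sqr L0 k0;
  suff -> : space_int L (fun x => mode L k 0 x * mode L k 0 x) = 0.
  by rewrite ltxx.
transitivity (\int[lebesgue_rV d]_(x in cell L) (0 : R)); last first.
  by rewrite Rintegral_cst ?mul0r//; exact: measurable_cell.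
apply: ae_eq_Rintegral => //; first exact: measurable_cell.
  apply: measurable_funTS; apply: measurable_funM; exact: measurable_mode.
apply: ae_imply tu => x /[apply] /rowP/(_ j); rewrite !mxE => /eqP.
rewrite -subr_eq0 addrAC subrr add0r mulf_eq0 (negbTE aj) orbF => /eqP ->.
by rewrite mul0r.
Qed.

End nonuniqueness.

Theorem theorem4 (R : realType) (d : nat) (hd : d = 2%N \/ d = 3%N)
  (L : 'rV[R]_d) (hL : forall i, 0 < L 0 i)
  (eta T : R) (heta : 0 < eta) (hT : 0 < T) (F : 'rV[R]_d)
  (b : R -> 'rV[R]_d -> 'rV[R]_d)
  (hbL2 : L2_Hper T L 2 b) (hbC : C_Hper T L 1 b)
  (v : R -> 'rV[R]_d -> 'rV[R]_d)
  (hv : velocity_solution T eta L F b v) :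
  (forall w, velocity_solution T eta L F b w -> field_eq T L w v) <->
  incommensurable L F.
Proof.
split=> [uniq|inc w hw]; first exact: (unique_incommensurable hd hL hT hv uniq).
exact: (incommensurable_unique hd hL inc hv hw).
Qed.
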